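(* Let $W$ be an irreducible finite Weyl group with simple reflections $s_1,\dots,s_n$, let $\mathcal{C}_W$ be the Clifford algebra of its reflection representation, let $\beta_i\in\mathcal{C}_W$ be the normalized simple roots, and let $\mathbb{C}W^-$ be the spin Weyl group algebra with generators $t_1,\dots,t_n$. Then there is an isomorphism of superalgebras $$\Phi:\ \mathcal{C}_W\rtimes\mathbb{C}W\ \xrightarrow{\ \simeq\ }\ \mathcal{C}_W\otimes\mathbb{C}W^-$$ which extends the identity map on $\mathcal{C}_W$ and sends $s_i\mapsto -\sqrt{-1}\,\beta_i t_i$ for each $i$. The inverse map $\Psi$ is the extension of the identity map on $\mathcal{C}_W$ which sends $t_i\mapsto \sqrt{-1}\,\beta_i s_i$ for each $i$.
   Context: All algebras are unital associative over $\mathbb{C}$; a superalgebra is a $\mathbb{Z}_2$-graded algebra. $W=\langle s_1,\dots,s_n \mid (s_is_j)^{m_{ij}}=1\rangle$ with $m_{ii}=1$, $m_{ij}=m_{ji}\ge 2$ for $i\ne j$, is an irreducible finite Weyl group (so $m_{ij}\in\{1,2,3,4,6\}$). $\mathfrak h$ is the (complex) reflection representation of $W$, with a $W$-invariant nondegenerate symmetric bilinear form $(-,-)$ (for $W=S_n$ of type $A_{n-1}$ one takes $\mathfrak h=\mathbb{C}^n$ with the permutation action and standard form, i.e. the Cartan subalgebra of $\mathfrak{gl}_n$). $\mathcal{C}_W$ is the Clifford algebra generated by $\mathfrak h$ (identified with $\mathfrak h^*$ via the form) with relations $xy+yx=(x,y)$ for $x,y\in\mathfrak h$; elements of $\mathfrak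 h$ are odd. $\beta_i\in\mathfrak h\subset\mathcal{C}_W$ is the $i$-th simple root rescaled by a positive scalar so that $\beta_i^2=1$, i.e. $(\beta_i,\beta_i)=2$; thus $(\beta_i,\beta_j)=-2\cos(\pi/m_{ij})$ and $s_i(x)=x-(x,\beta_i)\beta_i$ for $x\in\mathfrak h$. $W$ acts on $\mathcal{C}_W$ by algebra automorphisms, and $\mathcal{C}_W\rtimes\mathbb{C}W$ is the corresponding semidirect (smash) product, with $wx=w(x)w$ for $w\in W$, $x\in\mathcal{C}_W$; it is a superalgebra with elements of $W$ even. $\mathbb{C}W^-$ is the algebra generated by $t_1,\dots,t_n$ with relations $(t_it_j)^{m_{ij}}=(-1)^{m_{ij}+1}$ for all $i,j$ (in particular $t_i^2=1$); it has dimension $|W|$ and is a superalgebra with each $t_i$ odd. For superalgebras $\mathcal A,\mathcal B$, $\mathcal A\otimes\mathcal B$ is the superalgebra with product $(a\otimes b)(a'\otimes b')=(-1)^{|b||a'|}aa'\otimes bb'$ for homogeneous elements; $ab$ is short for $a\otimes b$, $a$ for $a\otimes 1$, $b$ for $1\otimes b$. *)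

(* Defs.v *)
From HB Require Import structures.
From mathcomp Require Import all_boot all_order all_fingroup all_algebra.
From mathcomp Require Import boolp reals complex.

Set Implicit Arguments.
Unset Strict Implicit.
Unset Printing Implicit Defensive.

Import generic_quotient GRing.Theory Num.Theory.
Local Open Scope ring_scope.
Local Open Scope quotient_scope.

(* An associative unital K-algebra A with a grading A = A_0 (+) A_1 by Z/2Z,  *)
(* the grading being given by the projections hpart p : A -> A_p, where the   *)
(* parity p is false for 0 and true for 1. The structure is built on          *)
(* pzRingType and not on algType, as the latter excludes the zero algebra,    *)
(* which cannot be excluded when an algebra is given by generators and        *)
(* relations. HB does not allow a common extension of pzRingType and lmodType *)
(* that is not an lalgType; this is why the K-action is a field of the mixin, *)
(* from which the structure of lmodType is recovered.                         *)
HB.mixin Record PzRing_isSuperAlgebra (K : fieldType) A of GRing.PzRing A := {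
  sscale : K -> A -> A;
  sscaleA : forall k l x, sscale k (sscale l x) = sscale (k * l) x;
  sscale1 : forall x, sscale 1 x = x;
  sscaleDr : forall k x y, sscale k (x + y) = sscale k x + sscale k y;
  sscaleDl : forall x k l, sscale (k + l) x = sscale k x + sscale l x;
  sscaleAl : forall k (x y : A), sscale k (x * y) = sscale k x * y;
  sscaleAr : forall k (x y : A), sscale k (x * y) = x * sscale k y;
  hpart : bool -> A -> A;
  hpartD : forall p x y, hpart p (x + y) = hpart p x + hpart p y;
  hpartZ : forall p k x, hpart p (sscale k x) = sscale k (hpart p x);
  hpart_sum : forall x, hpart false x + hpart true x = x;
  hpartK : forall p q x, hpart p (hpart q x) = if p == q then hpart q x else 0;
  hpart1 : hpart false 1 = 1;
  hpartMM : forall p q x y,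
    hpart (p (+) q) (hpart p x * hpart q y) = hpart p x * hpart q y
}.

#[short(type="superAlgType")]
HB.structure Definition SuperAlgebra (K : fieldType) :=
  {A of GRing.PzRing A & PzRing_isSuperAlgebra K A}.

HB.instance Definition _ (K : fieldType) (A : superAlgType K) :=
  GRing.Zmodule_isLmodule.Build K A
    (@sscaleA K A) (@sscale1 K A) (@sscaleDr K A) (@sscaleDl K A).

Section SuperLinear.
Variables (K : fieldType) (A : superAlgType K).

Lemma superAl (k : K) (x y : A) : k *: (x * y) = (k *: x) * y.
Proof. exact: sscaleAl. Qed.

Lemma superAr (k : K) (x y : A) : k *: (x * y) = x * (k *: y).
Proof. exact: sscaleAr. Qed.

Lemma hpart_is_linear p : linear (@hpart K A p).
Proof. by move=> k x y; rewrite hpartD [X in X + _]hpartZ. Qed.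

HB.instance Definition _ (p : bool) :=
  GRing.isLinear.Build K A A *:%R (hpart p) (hpart_is_linear p).

End SuperLinear.

Definition superalg_hom (K : fieldType) (A B : superAlgType K) (f : A -> B) :=
  [/\ linear f, GRing.monoid_morphism f
    & forall p x, f (hpart p x) = hpart p (f x)].

Section SuperTheory.
Variables (K : fieldType) (A : superAlgType K).
Implicit Types x y : A.

Lemma hpart_odd1 : hpart true (1 : A) = 0.
Proof. by apply: (addrI (hpart false 1)); rewrite hpart_sum addr0 hpart1. Qed.

Lemma hpartM p x y :
  hpart p (x * y)
  = hpart false x * hpart p y + hpart true x * hpart (~~ p) y.
Proof.
have hM s q r a b : hpart s (hpart q a * hpart r b)
    = if s == q (+) r then hpart q a * hpart r b else 0 :> A.
  by rewrite -(hpartMM q r a b) hpartK hpartMM; case: eqP => // ->.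
rewrite -{1}(hpart_sum x) -{1}(hpart_sum y) !(mulrDl, mulrDr) !raddfD /= !hM.
by case: p => /=; rewrite ?addr0 ?add0r // addrC.
Qed.

End SuperTheory.

Inductive term (K X : Type) : Type :=
| Tgen of X
| Tzero
| Tone
| Tadd of term K X & term K X
| Topp of term K X
| Tmul of term K X & term K X
| Tscale of K & term K X.

Arguments Tgen {K X}.
Arguments Tzero {K X}.
Arguments Tone {K X}.

Fixpoint Texp (K X : Type) (t : term K X) (n : nat) : term K X :=
  if n is n'.+1 then Tmul t (Texp t n') else Tone.

HB.instance Definition _ (K X : Type) := gen_eqMixin (term K X).
HB.instance Definition _ (K X : Type) := gen_choiceMixin (term K X).

(* Provable equality of algebra expressions modulo the relations rel. *)
Inductive pres_eq (K : fieldType) (X : Type)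
    (rel : term K X -> term K X -> Prop) : term K X -> term K X -> Prop :=
| Erel s t : rel s t -> pres_eq rel s t
| Erefl s : pres_eq rel s s
| Esym s t : pres_eq rel s t -> pres_eq rel t s
| Etrans s t u : pres_eq rel s t -> pres_eq rel t u -> pres_eq rel s u
| Eadd s s' t t' : pres_eq rel s s' -> pres_eq rel t t' ->
    pres_eq rel (Tadd s t) (Tadd s' t')
| Eopp s s' : pres_eq rel s s' -> pres_eq rel (Topp s) (Topp s')
| Emul s s' t t' : pres_eq rel s s' -> pres_eq rel t t' ->
    pres_eq rel (Tmul s t) (Tmul s' t')
| Escale k s s' : pres_eq rel s s' -> pres_eq rel (Tscale k s) (Tscale k s')
| EaddA s t u : pres_eq rel (Tadd s (Tadd t u)) (Tadd (Tadd s t) u)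
| EaddC s t : pres_eq rel (Tadd s t) (Tadd t s)
| Eadd0 s : pres_eq rel (Tadd Tzero s) s
| EaddN s : pres_eq rel (Tadd (Topp s) s) Tzero
| EmulA s t u : pres_eq rel (Tmul s (Tmul t u)) (Tmul (Tmul s t) u)
| Emul1 s : pres_eq rel (Tmul Tone s) s
| E1mul s : pres_eq rel (Tmul s Tone) s
| EmulDl s t u : pres_eq rel (Tmul (Tadd s t) u) (Tadd (Tmul s u) (Tmul t u))
| EmulDr s t u : pres_eq rel (Tmul s (Tadd t u)) (Tadd (Tmul s t) (Tmul s u))
| EscaleA k l s : pres_eq rel (Tscale k (Tscale l s)) (Tscale (k * l) s)
| Escale1 s : pres_eq rel (Tscale 1 s) s
| EscaleDr k s t :
    pres_eq rel (Tscale k (Tadd s t)) (Tadd (Tscale k s) (Tscale k t))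
| EscaleDl k l s :
    pres_eq rel (Tscale (k + l) s) (Tadd (Tscale k s) (Tscale l s))
| EscaleAl k s t : pres_eq rel (Tscale k (Tmul s t)) (Tmul (Tscale k s) t)
| EscaleAr k s t : pres_eq rel (Tscale k (Tmul s t)) (Tmul s (Tscale k t)).

(* The component of parity p of an expression in odd generators. *)
Fixpoint Thpart (K X : Type) (p : bool) (t : term K X) : term K X :=
  match t with
  | Tgen x => if p then Tgen x else Tzero
  | Tzero => Tzero
  | Tone => if p then Tzero else Tone
  | Tadd s t => Tadd (Thpart p s) (Thpart p t)
  | Topp s => Topp (Thpart p s)
  | Tmul s t => Tadd (Tmul (Thpart false s) (Thpart p t))
                     (Tmul (Thpart true s) (Thpart (~~ p) t))
  | Tscale k s => Tscale k (Thpart p s)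
  end.

Section PresentedAlgebra.
Variables (K : fieldType) (X : Type) (rel : term K X -> term K X -> Prop).

Definition pres_eqb (s t : term K X) : bool := `[< pres_eq rel s t >].

Lemma pres_eqb_refl : reflexive pres_eqb.
Proof. by move=> s; apply/asboolP/Erefl. Qed.

Lemma pres_eqb_sym : symmetric pres_eqb.
Proof. by move=> s t; apply/asboolP/asboolP => /Esym. Qed.

Lemma pres_eqb_trans : transitive pres_eqb.
Proof.
by move=> t s u /asboolP st /asboolP tu; apply/asboolP/(Etrans st tu).
Qed.

Canonical pres_equiv := EquivRel pres_eqb
  pres_eqb_refl pres_eqb_sym pres_eqb_trans.

Definition preAlg := {eq_quot pres_equiv}.
HB.instance Definition _ := Choice.on preAlg.
HB.instance Definition _ := EqQuotient.on preAlg.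

Definition Tpi (t : term K X) : preAlg := \pi_preAlg t.

Lemma TpiP s t : Tpi s = Tpi t <-> pres_eq rel s t.
Proof.
split=> [/eqP|st]; first by rewrite /Tpi eqmodE => /asboolP.
by apply/eqP; rewrite /Tpi eqmodE; apply/asboolP.
Qed.

Lemma repr_Tpi t : pres_eq rel (repr (Tpi t)) t.
Proof. by apply/TpiP; rewrite /Tpi reprK. Qed.

Lemma Tpi_repr x : Tpi (repr x) = x.
Proof. exact: reprK. Qed.

Lemma TpiW (P : preAlg -> Prop) : (forall t, P (Tpi t)) -> forall x, P x.
Proof. by move=> PT x; rewrite -(Tpi_repr x). Qed.

Definition pa_zero := Tpi Tzero.
Definition pa_one := Tpi Tone.
Definition pa_add (x y : preAlg) := Tpi (Tadd (repr x) (repr y)).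
Definition pa_opp (x : preAlg) := Tpi (Topp (repr x)).
Definition pa_mul (x y : preAlg) := Tpi (Tmul (repr x) (repr y)).
Definition pa_scale (k : K) (x : preAlg) := Tpi (Tscale k (repr x)).

Lemma pa_addE s t : pa_add (Tpi s) (Tpi t) = Tpi (Tadd s t).
Proof. by apply/TpiP/Eadd; apply: repr_Tpi. Qed.
Lemma pa_oppE s : pa_opp (Tpi s) = Tpi (Topp s).
Proof. by apply/TpiP/Eopp; apply: repr_Tpi. Qed.
Lemma pa_mulE s t : pa_mul (Tpi s) (Tpi t) = Tpi (Tmul s t).
Proof. by apply/TpiP/Emul; apply: repr_Tpi. Qed.
Lemma pa_scaleE k s : pa_scale k (Tpi s) = Tpi (Tscale k s).
Proof. by apply/TpiP/Escale; apply: repr_Tpi. Qed.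

Let paE := (pa_addE, pa_oppE, pa_mulE, pa_scaleE).

Lemma pa_addA : associative pa_add.
Proof.
by elim/TpiW=> s; elim/TpiW=> t; elim/TpiW=> u; rewrite !paE; apply/TpiP/EaddA.
Qed.
Lemma pa_addC : commutative pa_add.
Proof. by elim/TpiW=> s; elim/TpiW=> t; rewrite !paE; apply/TpiP/EaddC. Qed.
Lemma pa_add0 : left_id pa_zero pa_add.
Proof. by elim/TpiW=> s; rewrite !paE; apply/TpiP/Eadd0. Qed.
Lemma pa_addN : left_inverse pa_zero pa_opp pa_add.
Proof. by elim/TpiW=> s; rewrite !paE; apply/TpiP/EaddN. Qed.

HB.instance Definition _ :=
  GRing.isZmodule.Build preAlg pa_addA pa_addC pa_add0 pa_addN.

Lemma pa_mulA : associative pa_mul.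
Proof.
by elim/TpiW=> s; elim/TpiW=> t; elim/TpiW=> u; rewrite !paE; apply/TpiP/EmulA.
Qed.
Lemma pa_mul1 : left_id pa_one pa_mul.
Proof. by elim/TpiW=> s; rewrite !paE; apply/TpiP/Emul1. Qed.
Lemma pa_1mul : right_id pa_one pa_mul.
Proof. by elim/TpiW=> s; rewrite !paE; apply/TpiP/E1mul. Qed.
Lemma pa_mulDl : left_distributive pa_mul pa_add.
Proof.
by elim/TpiW=> s; elim/TpiW=> t; elim/TpiW=> u; rewrite !paE; apply/TpiP/EmulDl.
Qed.
Lemma pa_mulDr : right_distributive pa_mul pa_add.
Proof.
by elim/TpiW=> s; elim/TpiW=> t; elim/TpiW=> u; rewrite !paE; apply/TpiP/EmulDr.
Qed.

HB.instance Definition _ := GRing.Zmodule_isPzRing.Build preAlg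
  pa_mulA pa_mul1 pa_1mul pa_mulDl pa_mulDr.

Lemma pa_scaleA k l x : pa_scale k (pa_scale l x) = pa_scale (k * l) x.
Proof. by elim/TpiW: x => s; rewrite !paE; apply/TpiP/EscaleA. Qed.
Lemma pa_scale1 : left_id 1 pa_scale.
Proof. by elim/TpiW=> s; rewrite !paE; apply/TpiP/Escale1. Qed.
Lemma pa_scaleDr : right_distributive pa_scale +%R.
Proof.
move=> k; elim/TpiW=> s; elim/TpiW=> t.
rewrite -[X in pa_scale k X]/(pa_add _ _) -[RHS]/(pa_add _ _).
by rewrite !paE; apply/TpiP/EscaleDr.
Qed.
Lemma pa_scaleDl x : {morph pa_scale^~ x : k l / k + l}.
Proof.
move=> k l; elim/TpiW: x => s; rewrite /= -[RHS]/(pa_add _ _).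
by rewrite !paE; apply/TpiP/EscaleDl.
Qed.

HB.instance Definition _ := GRing.Zmodule_isLmodule.Build K preAlg
  pa_scaleA pa_scale1 pa_scaleDr pa_scaleDl.

Lemma TpiD s t : Tpi (Tadd s t) = Tpi s + Tpi t.
Proof. by rewrite -pa_addE. Qed.
Lemma TpiN s : Tpi (Topp s) = - Tpi s.
Proof. by rewrite -pa_oppE. Qed.
Lemma TpiM s t : Tpi (Tmul s t) = Tpi s * Tpi t.
Proof. by rewrite -pa_mulE. Qed.
Lemma TpiZ k s : Tpi (Tscale k s) = k *: Tpi s.
Proof. by rewrite -pa_scaleE. Qed.
Lemma Tpi0 : Tpi Tzero = 0. Proof. by []. Qed.
Lemma Tpi1 : Tpi Tone = 1. Proof. by []. Qed.
Lemma TpiX t n : Tpi (Texp t n) = Tpi t ^+ n.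
Proof. by elim: n => //= n IHn; rewrite TpiM IHn exprS. Qed.

Definition TpiE := (TpiD, TpiN, TpiM, TpiZ, Tpi0, Tpi1, TpiX).

Lemma pa_scaleAl (k : K) (x y : preAlg) : k *: (x * y) = (k *: x) * y.
Proof.
elim/TpiW: x => s; elim/TpiW: y => t.
by rewrite -!TpiE; apply/TpiP/EscaleAl.
Qed.
Lemma pa_scaleAr (k : K) (x y : preAlg) : k *: (x * y) = x * (k *: y).
Proof.
elim/TpiW: x => s; elim/TpiW: y => t.
by rewrite -!TpiE; apply/TpiP/EscaleAr.
Qed.

End PresentedAlgebra.

(* The relations have to be homogeneous for the algebra to be graded. *)
Record presentation (K : fieldType) (X : Type) := Presentation {
  prel :> term K X -> term K X -> Prop;
  prel_homog : forall p s t, prel s t ->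
    Tpi prel (Thpart p s) = Tpi prel (Thpart p t)
}.

Definition presAlg (K : fieldType) (X : Type) (P : presentation K X) : Type :=
  preAlg P.

Section PresentedSuperAlgebra.
Variables (K : fieldType) (X : Type) (P : presentation K X).
Local Notation A := (presAlg P).

HB.instance Definition _ := GRing.PzRing.on A.
HB.instance Definition _ := GRing.Lmodule.on A.

Lemma Thpart_eq p s t : pres_eq P s t ->
  Tpi P (Thpart p s) = Tpi P (Thpart p t).
Proof.
move=> st; elim: st p => {s t} /=.
- by move=> s t st p; exact: prel_homog.
- by [].
- by move=> s t _ IH p; rewrite IH.
- by move=> s t u _ IH1 _ IH2 p; rewrite IH1.
- by move=> s s' t t' _ IH1 _ IH2 p; rewrite !TpiE IH1 IH2.
- by move=> s s' _ IH p; rewrite !TpiE IH.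
- by move=> s s' t t' _ IH1 _ IH2 p; rewrite !TpiE !IH1 !IH2.
- by move=> k s s' _ IH p; rewrite !TpiE IH.
- by move=> s t u p; rewrite !TpiE addrA.
- by move=> s t p; rewrite !TpiE addrC.
- by move=> s p; rewrite !TpiE add0r.
- by move=> s p; rewrite !TpiE addNr.
- move=> s t u p; rewrite !TpiE negbK /= !(mulrDl, mulrDr) !mulrA -!addrA.
  by congr (_ + _); rewrite addrCA [in RHS]addrCA addrC -!addrA; congr (_ + _);
    rewrite ?addrA ?[in LHS]addrC.
- by move=> s [] /=; rewrite !TpiE mul1r mul0r addr0.
- by move=> s [] /=; rewrite !TpiE ?mulr0 ?mulr1 ?addr0 ?add0r.
- by move=> s t u p; rewrite !TpiE !mulrDl addrACA.
- by move=> s t u p; rewrite !TpiE !mulrDr addrACA.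
- by move=> k l s p; rewrite !TpiE scalerA.
- by move=> s p; rewrite !TpiE scale1r.
- by move=> k s t p; rewrite !TpiE scalerDr.
- by move=> k l s p; rewrite !TpiE scalerDl.
- by move=> k s t p; rewrite !TpiE scalerDr !pa_scaleAl.
- by move=> k s t p; rewrite !TpiE scalerDr !pa_scaleAr.
Qed.

Definition pa_hpart (p : bool) (x : A) : A := Tpi P (Thpart p (repr x)).

Lemma pa_hpartE p t : pa_hpart p (Tpi P t) = Tpi P (Thpart p t).
Proof. exact/Thpart_eq/repr_Tpi. Qed.

Lemma pa_hpart_linear p : linear (pa_hpart p).
Proof.
move=> k x y; elim/TpiW: x => s; elim/TpiW: y => t.
by rewrite -TpiZ -TpiD !pa_hpartE /= !TpiE.
Qed.

HB.instance Definition _ p :=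
  GRing.isLinear.Build K A A *:%R (pa_hpart p) (pa_hpart_linear p).

Lemma pa_hpartD p x y : pa_hpart p (x + y) = pa_hpart p x + pa_hpart p y.
Proof. exact: raddfD. Qed.

Lemma pa_hpartZ p k x : pa_hpart p (k *: x) = k *: pa_hpart p x.
Proof. exact: linearZ. Qed.

Lemma pa_hpart_sum x : pa_hpart false x + pa_hpart true x = x.
Proof.
elim/TpiW: x => t; rewrite !pa_hpartE.
elim: t => /= [x|||s IHs t IHt|s IHs|s IHs t IHt|k s IHs];
  rewrite ?TpiE ?addr0 ?add0r //.
- by rewrite addrACA IHs IHt.
- by rewrite -opprD IHs.
- by rewrite addrACA -!mulrDr [_ (Thpart true t) + _]addrC -mulrDl IHs IHt.
- by rewrite -scalerDr IHs.
Qed.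

Lemma pa_hpartK p q x :
  pa_hpart p (pa_hpart q x) = if p == q then pa_hpart q x else 0.
Proof.
elim/TpiW: x => t; rewrite !pa_hpartE.
elim: t p q => /= [x|||s IHs t IHt|s IHs|s IHs t IHt|k s IHs] p q.
- by case: p; case: q.
- by case: eqP.
- by case: p; case: q.
- by rewrite !TpiE IHs IHt; case: eqP; rewrite ?addr0.
- by rewrite !TpiE IHs; case: eqP; rewrite ?oppr0.
- rewrite !TpiE !IHs !IHt /=.
  by case: p; case: q; rewrite /= ?mul0r ?mulr0 ?addr0 ?add0r // ?[RHS]addrC.
- by rewrite !TpiE IHs; case: eqP; rewrite ?scaler0.
Qed.

Lemma pa_hpart1 : pa_hpart false 1 = 1.
Proof. by rewrite -[1]/(Tpi P Tone) pa_hpartE. Qed.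

Lemma pa_hpartMM p q x y :
  pa_hpart (p (+) q) (pa_hpart p x * pa_hpart q y)
  = pa_hpart p x * pa_hpart q y.
Proof.
have hM r a b : pa_hpart r (a * b)
    = pa_hpart false a * pa_hpart r b + pa_hpart true a * pa_hpart (~~ r) b.
  elim/TpiW: a => s; elim/TpiW: b => t.
  by rewrite -TpiM !pa_hpartE /= !TpiE.
rewrite hM !pa_hpartK.
by case: p; case: q; rewrite /= ?mul0r ?mulr0 ?addr0 ?add0r.
Qed.

HB.instance Definition _ := PzRing_isSuperAlgebra.Build K A
  (@scalerA K A) (@scale1r K A) (@scalerDr K A) (@scalerDl K A)
  (@pa_scaleAl K X P) (@pa_scaleAr K X P)
  pa_hpartD pa_hpartZ pa_hpart_sum pa_hpartK pa_hpart1 pa_hpartMM.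

Definition pgen (x : X) : A := Tpi P (Tgen x).

Lemma pgen_odd x p : hpart p (pgen x) = if p then pgen x else 0.
Proof. by rewrite [LHS]pa_hpartE; case: p. Qed.

Section Lift.
Variables (B : superAlgType K) (f : X -> B).

Fixpoint Teval (t : term K X) : B :=
  match t with
  | Tgen x => f x
  | Tzero => 0
  | Tone => 1
  | Tadd s t => Teval s + Teval t
  | Topp s => - Teval s
  | Tmul s t => Teval s * Teval t
  | Tscale k s => k *: Teval s
  end.

Definition plift (x : A) : B := Teval (repr x).

Hypothesis f_rel : forall s t, P s t -> Teval s = Teval t.

Lemma Teval_eq s t : pres_eq P s t -> Teval s = Teval t.
Proof.
elim=> {s t} //=.
- by move=> s t u _ ->.
- by move=> s s' t t' _ -> _ ->.
- by move=> s s' _ ->.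
- by move=> s s' t t' _ -> _ ->.
- by move=> k s s' _ ->.
- by move=> s t u; rewrite addrA.
- by move=> s t; rewrite addrC.
- by move=> s; rewrite add0r.
- by move=> s; rewrite addNr.
- by move=> s t u; rewrite mulrA.
- by move=> s; rewrite mul1r.
- by move=> s; rewrite mulr1.
- by move=> s t u; rewrite mulrDl.
- by move=> s t u; rewrite mulrDr.
- by move=> k l s; rewrite scalerA.
- by move=> s; rewrite scale1r.
- by move=> k s t; rewrite scalerDr.
- by move=> k l s; rewrite scalerDl.
- by move=> k s t; rewrite superAl.
- by move=> k s t; rewrite superAr.
Qed.

Lemma pliftE t : plift (Tpi P t) = Teval t.
Proof. exact/Teval_eq/repr_Tpi. Qed.

Lemma plift_gen x : plift (pgen x) = f x.
Proof. exact: pliftE. Qed.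

Hypothesis f_odd : forall x, hpart true (f x) = f x.

Lemma plift_hom : superalg_hom plift.
Proof.
have f_even x : hpart false (f x) = 0.
  by apply: (addIr (hpart true (f x))); rewrite hpart_sum f_odd add0r.
split.
- move=> k x y; elim/TpiW: x => s; elim/TpiW: y => t.
  by rewrite -TpiZ -TpiD !pliftE.
- split=> [|]; first exact: pliftE.
  by move=> x y; elim/TpiW: x => s; elim/TpiW: y => t; rewrite -TpiM !pliftE.
- move=> p x; elim/TpiW: x => t; rewrite [hpart p _]pa_hpartE !pliftE.
  elim: t p => /= [x|||s IHs t IHt|s IHs|s IHs t IHt|k s IHs] p.
  + by case: p => /=; rewrite ?f_odd ?f_even.
  + by rewrite raddf0.
  + by case: p => /=; rewrite ?hpart1 ?hpart_odd1.
  + by rewrite raddfD IHs IHt.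
  + by rewrite raddfN IHs.
  + by rewrite hpartM !IHs !IHt.
  + by rewrite linearZ IHs.
Qed.

End Lift.

Lemma presAlg_hom_ext (B : superAlgType K) (f g : A -> B) :
  superalg_hom f -> superalg_hom g -> (forall x, f (pgen x) = g (pgen x)) ->
  f =1 g.
Proof.
move=> [fL fM _] [gL gM _] fg; elim/TpiW.
pose fl : {linear A -> B} := HB.pack f (GRing.isLinear.Build K A B *:%R f fL).
pose gl : {linear A -> B} := HB.pack g (GRing.isLinear.Build K A B *:%R g gL).
rewrite -[f]/(fl : A -> B) -[g]/(gl : A -> B).
elim=> [x|||s IHs t IHt|s IHs|s IHs t IHt|k s IHs]; rewrite ?TpiE.
- exact: fg.
- by rewrite !raddf0.
- by rewrite [LHS]fM.1 [RHS]gM.1.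
- rewrite !raddfD; by congr (_ + _).
- by rewrite !raddfN; congr (- _).
- by rewrite [LHS]fM.2 [RHS]gM.2; congr (_ * _).
- by rewrite !linearZ IHs.
Qed.

End PresentedSuperAlgebra.

Section Clifford.
Variables (K : fieldType) (V : lmodType K) (b : V -> V -> K).

Inductive clifford_rel : term K V -> term K V -> Prop :=
| Clifford_linear k x y :
    clifford_rel (Tgen (k *: x + y)) (Tadd (Tscale k (Tgen x)) (Tgen y))
| Clifford_anticomm x y :
    clifford_rel (Tadd (Tmul (Tgen x) (Tgen y)) (Tmul (Tgen y) (Tgen x)))
                 (Tscale (b x y) Tone).

Lemma clifford_homog p s t : clifford_rel s t ->
  Tpi clifford_rel (Thpart p s) = Tpi clifford_rel (Thpart p t).
Proof.
case=> [k x y|x y]; case: p; rewrite /= !TpiE.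
- by rewrite -!TpiE; apply/TpiP/Erel/Clifford_linear.
- by rewrite scaler0 addr0.
- by rewrite !mul0r !mulr0 !addr0 scaler0.
- rewrite !mul0r !add0r -!TpiE.
  exact/TpiP/Erel/Clifford_anticomm.
Qed.

Definition clifford_pres := Presentation clifford_homog.
Definition clifford : Type := presAlg clifford_pres.
HB.instance Definition _ := SuperAlgebra.on clifford.
HB.instance Definition _ := GRing.Lmodule.on clifford.

Definition cliff (x : V) : clifford := pgen clifford_pres x.

Lemma cliff_linear : linear cliff.
Proof.
move=> k x y; have /TpiP := Erel (Clifford_linear k x y).
by rewrite !TpiE.
Qed.

HB.instance Definition _ :=
  GRing.isLinear.Build K V clifford *:%R cliff cliff_linear.

Lemma cliff_anticomm x y :
  cliff x * cliff y + cliff y * cliff x = b x y *: (1 : clifford).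
Proof. by have /TpiP := Erel (Clifford_anticomm x y); rewrite !TpiE. Qed.

End Clifford.

Section SpinAlgebra.
Variables (K : fieldType) (n : nat) (m : 'I_n -> 'I_n -> nat).

Inductive spin_rel : term K 'I_n -> term K 'I_n -> Prop :=
| Spin_braid i j :
    spin_rel (Texp (Tmul (Tgen i) (Tgen j)) (m i j))
             (Tscale ((-1) ^+ (m i j).+1) Tone).

Lemma spin_homog p s t : spin_rel s t ->
  Tpi spin_rel (Thpart p s) = Tpi spin_rel (Thpart p t).
Proof.
case=> i j; set u := Tmul _ _.
have hX k q : Tpi spin_rel (Thpart q (Texp u k))
            = if q then 0 else Tpi spin_rel (Texp u k).
  elim: k q => [|k IHk] [] //=; rewrite !TpiE !IHk /=;
    by rewrite !(mul0r, mulr0, add0r, addr0) ?TpiE.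
rewrite hX; case: p => /=; rewrite !TpiE ?scaler0 //.
by rewrite -!TpiE; apply/TpiP/Erel/Spin_braid.
Qed.

Definition spin_pres := Presentation spin_homog.
Definition spinalg : Type := presAlg spin_pres.
HB.instance Definition _ := SuperAlgebra.on spinalg.
HB.instance Definition _ := GRing.Lmodule.on spinalg.

Definition spin (i : 'I_n) : spinalg := pgen spin_pres i.

Lemma spin_braid i j :
  (spin i * spin j) ^+ m i j = (-1) ^+ (m i j).+1 *: (1 : spinalg).
Proof. by have /TpiP := Erel (Spin_braid i j); rewrite !TpiE. Qed.

End SpinAlgebra.

Record superAction (K : fieldType) (W : finGroupType) (A : superAlgType K) :=
SuperAction {
  sact :> W -> A -> A;
  sact_hom : forall w, superalg_hom (sact w);
  sact1 : forall x, sact 1%g x = x;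
  sactM : forall w w' x, sact (w * w')%g x = sact w (sact w' x)
}.

Section SuperActionTheory.
Variables (K : fieldType) (W : finGroupType) (A : superAlgType K).
Variable act : superAction W A.

HB.instance Definition _ w := GRing.isLinear.Build K A A *:%R (act w)
  (let: And3 fL _ _ := sact_hom act w in fL).

Lemma sact_sum w (I : finType) (F : I -> A) :
  act w (\sum_i F i) = \sum_i act w (F i).
Proof. exact: raddf_sum. Qed.

Lemma sact_one w : act w 1 = 1.
Proof. by have [_ [f1 _] _] := sact_hom act w. Qed.

Lemma sact_mul w x y : act w (x * y) = act w x * act w y.
Proof. by have [_ [_ fM] _] := sact_hom act w. Qed.

Lemma sact_hpart w p x : act w (hpart p x) = hpart p (act w x).
Proof. by have [_ _ fP] := sact_hom act w. Qed.

End SuperActionTheory.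

(* f : smash act stands for the sum of the (f w) w over w in W. *)
Definition smash (K : fieldType) (W : finGroupType) (A : superAlgType K)
  (act : superAction W A) : Type := {ffun W -> A}.

Section SmashProduct.
Variables (K : fieldType) (W : finGroupType) (A : superAlgType K).
Variable act : superAction W A.
Local Notation S := (smash act).

HB.instance Definition _ := GRing.Zmodule.copy S {ffun W -> A}.
HB.instance Definition _ := GRing.Lmodule.copy S {ffun W -> A}.

Definition smash_alg (a : A) : S := [ffun w => if w == 1%g then a else 0].
Definition smash_grp (u : W) : S := [ffun w => if w == u then 1 else 0].
Definition smash_mul (f g : S) : S :=
  [ffun w => \sum_(u : W) f u * act u (g (u^-1 * w)%g)].

Lemma smash_mulA : associative smash_mul.
Proof.
move=> f g h; apply/ffunP=> w; rewrite !ffunE.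
under eq_bigr => u _.
  rewrite ffunE sact_sum mulr_sumr.
  under eq_bigr => v _ do rewrite sact_mul -sactM mulrA.
  rewrite (reindex_inj (mulgI u^-1%g)).
  over.
rewrite exchange_big; apply: eq_bigr => v _.
rewrite ffunE mulr_suml; apply: eq_bigr => u _.
by rewrite mulKVg invMg invgK -!mulgA mulKVg.
Qed.

Lemma smash_mul1 : left_id (smash_alg 1) smash_mul.
Proof.
move=> f; apply/ffunP=> w; rewrite !ffunE (bigD1 1%g) //=.
rewrite big1 => [|u /negPf u1].
  by rewrite ffunE eqxx mul1r sact1 invg1 mul1g addr0.
by rewrite ffunE u1 mul0r.
Qed.

Lemma smash_1mul : right_id (smash_alg 1) smash_mul.
Proof.
move=> f; apply/ffunP=> w; rewrite !ffunE (bigD1 w) //= big1 => [|u /negPf uw].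
  by rewrite ffunE mulVg eqxx sact_one mulr1 addr0.
by rewrite ffunE -eq_mulVg1 uw raddf0 mulr0.
Qed.

Lemma smash_mulDl : left_distributive smash_mul +%R.
Proof.
move=> f g h; apply/ffunP=> w; rewrite !ffunE -big_split.
by apply: eq_bigr => u _; rewrite !ffunE mulrDl.
Qed.

Lemma smash_mulDr : right_distributive smash_mul +%R.
Proof.
move=> f g h; apply/ffunP=> w; rewrite !ffunE -big_split.
by apply: eq_bigr => u _; rewrite !ffunE raddfD mulrDr.
Qed.

HB.instance Definition _ := GRing.Zmodule_isPzRing.Build S
  smash_mulA smash_mul1 smash_1mul smash_mulDl smash_mulDr.

Lemma smash_scaleAl (k : K) (f g : S) : k *: (f * g) = (k *: f) * g.
Proof.
apply/ffunP=> w; rewrite !ffunE scaler_sumr.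
by apply: eq_bigr => u _; rewrite !ffunE superAl.
Qed.

Lemma smash_scaleAr (k : K) (f g : S) : k *: (f * g) = f * (k *: g).
Proof.
apply/ffunP=> w; rewrite !ffunE scaler_sumr.
by apply: eq_bigr => u _; rewrite !ffunE linearZ /= superAr.
Qed.

(* The elements of W are even. *)
Definition smash_hpart (p : bool) (f : S) : S := [ffun w => hpart p (f w)].

Lemma smash_hpartD p (f g : S) :
  smash_hpart p (f + g) = smash_hpart p f + smash_hpart p g.
Proof. by apply/ffunP=> w; rewrite !ffunE raddfD. Qed.

Lemma smash_hpartZ p k (f : S) :
  smash_hpart p (k *: f) = k *: smash_hpart p f.
Proof. by apply/ffunP=> w; rewrite !ffunE linearZ. Qed.

Lemma smash_hpart_sum (f : S) : smash_hpart false f + smash_hpart true f = f.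
Proof. by apply/ffunP=> w; rewrite !ffunE hpart_sum. Qed.

Lemma smash_hpartK p q (f : S) :
  smash_hpart p (smash_hpart q f) = if p == q then smash_hpart q f else 0.
Proof. by apply/ffunP=> w; rewrite !ffunE hpartK; case: eqP; rewrite ffunE. Qed.

Lemma smash_hpart1 : smash_hpart false 1 = 1.
Proof.
by apply/ffunP=> w; rewrite !ffunE; case: eqP; rewrite ?hpart1 ?raddf0.
Qed.

Lemma smash_hpartMM p q (f g : S) :
  smash_hpart (p (+) q) (smash_hpart p f * smash_hpart q g)
  = smash_hpart p f * smash_hpart q g.
Proof.
apply/ffunP=> w; rewrite !ffunE raddf_sum; apply: eq_bigr => u _.
rewrite !ffunE sact_hpart; exact: hpartMM.
Qed.

HB.instance Definition _ := PzRing_isSuperAlgebra.Build K S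
  (@scalerA K S) (@scale1r K S) (@scalerDr K S) (@scalerDl K S)
  smash_scaleAl smash_scaleAr
  smash_hpartD smash_hpartZ smash_hpart_sum smash_hpartK smash_hpart1
  smash_hpartMM.

Lemma smash_mulE (f g : S) w :
  (f * g) w = \sum_(u : W) f u * act u (g (u^-1 * w)%g).
Proof. by rewrite [LHS]ffunE. Qed.

Lemma smash_grp_alg u a : smash_grp u * smash_alg a
                        = smash_alg (act u a) * smash_grp u.
Proof.
apply/ffunP=> w; rewrite !smash_mulE (bigD1 u) //= [RHS](bigD1 1%g) //=.
rewrite !big1 => [|v /negPf v1|v /negPf vu]; rewrite !ffunE ?eqxx ?mul1r ?addr0.
- rewrite invg1 mul1g -eq_mulVg1 [u == w]eq_sym.
  by case: eqP; rewrite ?sact_one ?raddf0 ?mulr1 ?mulr0.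
- by rewrite v1 mul0r.
- by rewrite vu mul0r.
Qed.

End SmashProduct.

Section TensorSpace.
Variables (K : fieldType) (A B : lmodType K).

(* A formal sum of pairs (a, b), each standing for a (x) b; two of them are   *)
(* the same tensor when no bilinear map separates them.                       *)
Definition tens_eqb (s t : seq (A * B)) : bool :=
  `[< forall (V : lmodType K) (f : {bilinear A -> B -> V}),
      \sum_(u <- s) f u.1 u.2 = \sum_(u <- t) f u.1 u.2 >].

Lemma tens_eqb_refl : reflexive tens_eqb.
Proof. by move=> s; apply/asboolP. Qed.

Lemma tens_eqb_sym : symmetric tens_eqb.
Proof. by move=> s t; apply/asboolP/asboolP => st V f; rewrite st. Qed.

Lemma tens_eqb_trans : transitive tens_eqb.
Proof.
by move=> t s u /asboolP st /asboolP tu; apply/asboolP=> V f; rewrite st.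
Qed.

Canonical tens_equiv := EquivRel tens_eqb
  tens_eqb_refl tens_eqb_sym tens_eqb_trans.

Definition tens := {eq_quot tens_equiv}.
HB.instance Definition _ := Choice.on tens.
HB.instance Definition _ := EqQuotient.on tens.

Definition tens_lift (V : lmodType K) (f : A -> B -> V) (x : tens) : V :=
  \sum_(u <- repr x) f u.1 u.2.

Definition tpi (s : seq (A * B)) : tens := \pi_tens s.

Lemma tpiP s t : (forall (V : lmodType K) (f : {bilinear A -> B -> V}),
    \sum_(u <- s) f u.1 u.2 = \sum_(u <- t) f u.1 u.2) <-> tpi s = tpi t.
Proof.
split=> [st|/eqP]; first by apply/eqP; rewrite /tpi eqmodE; apply/asboolP.
by rewrite /tpi eqmodE => /asboolP.
Qed.

Lemma tens_liftE (V : lmodType K) (f : {bilinear A -> B -> V}) s :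
  tens_lift f (tpi s) = \sum_(u <- s) f u.1 u.2.
Proof. by move: V f; apply/tpiP; rewrite /tpi reprK. Qed.

Lemma tens_eqP x y : (forall (V : lmodType K) (f : {bilinear A -> B -> V}),
  tens_lift f x = tens_lift f y) -> x = y.
Proof.
by move=> xy; rewrite -[x]reprK -[y]reprK; apply/tpiP => V f; apply: xy.
Qed.

Definition tens_zero := tpi [::].
Definition tens_add (x y : tens) := tpi (repr x ++ repr y).
Definition tens_scale (k : K) (x : tens) :=
  tpi [seq (k *: u.1, u.2) | u <- repr x].
Definition tens_opp (x : tens) := tens_scale (-1) x.

Section Ops.
Variables (V : lmodType K) (f : {bilinear A -> B -> V}).

Lemma tens_lift0 : tens_lift f tens_zero = 0.
Proof. by rewrite tens_liftE big_nil. Qed.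

Lemma tens_liftD x y :
  tens_lift f (tens_add x y) = tens_lift f x + tens_lift f y.
Proof. by rewrite tens_liftE big_cat. Qed.

Lemma tens_liftZ k x : tens_lift f (tens_scale k x) = k *: tens_lift f x.
Proof.
rewrite tens_liftE big_map /= /tens_lift scaler_sumr; apply: eq_bigr => u _.
exact: linearZl_LR.
Qed.

Lemma tens_liftN x : tens_lift f (tens_opp x) = - tens_lift f x.
Proof. by rewrite tens_liftZ scaleN1r. Qed.

End Ops.

Let tlE := (tens_lift0, tens_liftD, tens_liftN, tens_liftZ).

Lemma tens_addA : associative tens_add.
Proof. by move=> x y z; apply/tens_eqP=> V f; rewrite !tlE addrA. Qed.
Lemma tens_addC : commutative tens_add.
Proof. by move=> x y; apply/tens_eqP=> V f; rewrite !tlE addrC. Qed.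
Lemma tens_add0 : left_id tens_zero tens_add.
Proof. by move=> x; apply/tens_eqP=> V f; rewrite !tlE add0r. Qed.
Lemma tens_addN : left_inverse tens_zero tens_opp tens_add.
Proof. by move=> x; apply/tens_eqP=> V f; rewrite !tlE addNr. Qed.

HB.instance Definition _ :=
  GRing.isZmodule.Build tens tens_addA tens_addC tens_add0 tens_addN.

Lemma tens_scaleA k l x : tens_scale k (tens_scale l x) = tens_scale (k * l) x.
Proof. by apply/tens_eqP=> V f; rewrite !tlE scalerA. Qed.
Lemma tens_scale1 : left_id 1 tens_scale.
Proof. by move=> x; apply/tens_eqP=> V f; rewrite !tlE scale1r. Qed.
Lemma tens_scaleDr : right_distributive tens_scale +%R.
Proof. by move=> k x y; apply/tens_eqP=> V f; rewrite !tlE scalerDr. Qed.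
Lemma tens_scaleDl x : {morph tens_scale^~ x : k l / k + l}.
Proof. by move=> k l; apply/tens_eqP=> V f; rewrite !tlE scalerDl. Qed.

HB.instance Definition _ := GRing.Zmodule_isLmodule.Build K tens
  tens_scaleA tens_scale1 tens_scaleDr tens_scaleDl.

Definition pure (a : A) (b : B) : tens := tpi [:: (a, b)].

Lemma tens_lift_linear (V : lmodType K) (f : {bilinear A -> B -> V}) :
  linear (tens_lift f).
Proof. by move=> k x y; rewrite tens_liftD tens_liftZ. Qed.

HB.instance Definition _ (V : lmodType K) (f : {bilinear A -> B -> V}) :=
  GRing.isLinear.Build K tens V *:%R (tens_lift f) (tens_lift_linear f).

Lemma lift_pure (V : lmodType K) (f : {bilinear A -> B -> V}) a b :
  tens_lift f (pure a b) = f a b.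
Proof. by rewrite tens_liftE big_seq1. Qed.

Lemma pure_bilinear : bilinear_for *:%R *:%R pure.
Proof.
split=> [b k a a'|a k b b'] /=; apply/tens_eqP=> V f;
  rewrite linearP /= !lift_pure.
  exact: linearPl.
exact: linearPr.
Qed.

HB.instance Definition _ := bilinear_isBilinear.Build K A B tens *:%R *:%R
  pure pure_bilinear.

Lemma tens_sum x : x = \sum_(u <- repr x) pure u.1 u.2.
Proof.
apply/tens_eqP=> V f; rewrite raddf_sum.
by apply: eq_bigr => u _; apply: esym; apply: lift_pure.
Qed.

Lemma tens_ind (P : tens -> Prop) :
  P 0 -> (forall x y, P x -> P y -> P (x + y)) -> (forall a b, P (pure a b)) ->
  forall x, P x.
Proof.
by move=> P0 PD Ppure x; rewrite [x]tens_sum; apply: (big_ind P) => // u _.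
Qed.

Lemma tens_ext (V : lmodType K) (f g : {linear tens -> V}) :
  (forall a b, f (pure a b) = g (pure a b)) -> f =1 g.
Proof.
move=> fg; elim/tens_ind=> [|x y fx fy|//]; first by rewrite !raddf0.
by rewrite [LHS]raddfD [RHS]raddfD; congr (_ + _).
Qed.

End TensorSpace.

Definition stens (K : fieldType) (A B : superAlgType K) : Type := tens A B.

Section SuperTensor.
Variables (K : fieldType) (A B : superAlgType K).
Local Notation T := (stens A B).

HB.instance Definition _ := GRing.Zmodule.copy T (tens A B).
HB.instance Definition _ := GRing.Lmodule.copy T (tens A B).

Definition spure (a : A) (b : B) : T := pure a b.
HB.instance Definition _ := bilinear_isBilinear.Build K A B T *:%R *:%R
  spure (@pure_bilinear K A B).

(* The product of a (x) b and a' (x) b'; b and a' may be inhomogeneous. *)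
Definition tmul (a : A) (b : B) (a' : A) (b' : B) : T :=
  \sum_(p : bool) \sum_(q : bool)
    (-1) ^+ (p && q) *: spure (a * hpart q a') (hpart p b * b').

Lemma spure_l b k x y : spure (k *: x + y) b = k *: spure x b + spure y b.
Proof. exact: linearPl. Qed.

Lemma spure_r a k x y : spure a (k *: x + y) = k *: spure a x + spure a y.
Proof. exact: linearPr. Qed.

Lemma tmul_l b a' b' k x y :
  tmul (k *: x + y) b a' b' = k *: tmul x b a' b' + tmul y b a' b'.
Proof.
rewrite scaler_sumr -big_split; apply: eq_bigr => p _.
rewrite scaler_sumr -big_split; apply: eq_bigr => q _ /=.
by rewrite mulrDl -superAl spure_l scalerDr !scalerA mulrC.
Qed.

Lemma tmul_r a a' b' k x y :
  tmul a (k *: x + y) a' b' = k *: tmul a x a' b' + tmul a y a' b'.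
Proof.
rewrite scaler_sumr -big_split; apply: eq_bigr => p _.
rewrite scaler_sumr -big_split; apply: eq_bigr => q _ /=.
by rewrite hpart_is_linear mulrDl -superAl spure_r scalerDr !scalerA mulrC.
Qed.

Lemma tmul_bilinear a b : bilinear_for *:%R *:%R (tmul a b).
Proof.
split=> [b' k x y|a' k x y] /=.
  rewrite scaler_sumr -big_split; apply: eq_bigr => p _.
  rewrite scaler_sumr -big_split; apply: eq_bigr => q _ /=.
  by rewrite hpart_is_linear mulrDr -superAr spure_l scalerDr !scalerA mulrC.
rewrite scaler_sumr -big_split; apply: eq_bigr => p _.
rewrite scaler_sumr -big_split; apply: eq_bigr => q _ /=.
by rewrite mulrDr -superAr spure_r scalerDr !scalerA mulrC.
Qed.

HB.instance Definition _ a b := bilinear_isBilinear.Build K A B T *:%R *:%R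
  (tmul a b) (tmul_bilinear a b).

Definition tmulr (y : T) (a : A) (b : B) : T := tens_lift (tmul a b) y.

Lemma tmulr_bilinear y : bilinear_for *:%R *:%R (tmulr y).
Proof.
split=> [b k x z|a k x z] /=; rewrite /tmulr /tens_lift scaler_sumr -big_split;
  by apply: eq_bigr => u _; rewrite ?tmul_l ?tmul_r.
Qed.

HB.instance Definition _ y := bilinear_isBilinear.Build K A B T *:%R *:%R
  (tmulr y) (tmulr_bilinear y).

Definition stens_mul (x y : T) : T := tens_lift (tmulr y) x.

Lemma stens_mul_l y k x x' :
  stens_mul (k *: x + x') y = k *: stens_mul x y + stens_mul x' y.
Proof. exact: tens_lift_linear. Qed.

Lemma stens_mul_r x k y y' :
  stens_mul x (k *: y + y') = k *: stens_mul x y + stens_mul x y'.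
Proof.
rewrite /stens_mul /tens_lift scaler_sumr -big_split; apply: eq_bigr => u _ /=.
exact: tens_lift_linear.
Qed.

Lemma stens_mulDl : left_distributive stens_mul +%R.
Proof.
by move=> x y z; have := stens_mul_l z 1 x y; rewrite !scale1r.
Qed.

Lemma stens_mulDr : right_distributive stens_mul +%R.
Proof.
by move=> x y z; have := stens_mul_r x 1 y z; rewrite !scale1r.
Qed.

Lemma stens_mul0l x : stens_mul 0 x = 0.
Proof. by apply: (addrI (stens_mul 0 x)); rewrite -stens_mulDl !addr0. Qed.

Lemma stens_mul0r x : stens_mul x 0 = 0.
Proof. by apply: (addrI (stens_mul x 0)); rewrite -stens_mulDr !addr0. Qed.

Lemma stens_scaleAl k x y : k *: stens_mul x y = stens_mul (k *: x) y.
Proof. by have := stens_mul_l y k x 0; rewrite stens_mul0l !addr0. Qed.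

Lemma stens_scaleAr k x y : k *: stens_mul x y = stens_mul x (k *: y).
Proof. by have := stens_mul_r x k y 0; rewrite stens_mul0r !addr0. Qed.

Lemma stens_mul_pure a b a' b' : stens_mul (spure a b) (spure a' b')
  = \sum_(p : bool) \sum_(q : bool)
      (-1) ^+ (p && q) *: spure (a * hpart q a') (hpart p b * b').
Proof.
rewrite [LHS](lift_pure (tmulr (spure a' b'))).
exact: (lift_pure (tmul a b)).
Qed.

Lemma spure0l b : spure 0 b = 0.
Proof. by have := spure_l b (-1) 0 0; rewrite scaler0 addr0 scaleN1r addNr. Qed.

Lemma spure0r a : spure a 0 = 0.
Proof. by have := spure_r a (-1) 0 0; rewrite scaler0 addr0 scaleN1r addNr. Qed.

Lemma spureDl b x y : spure (x + y) b = spure x b + spure y b.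
Proof. by have := spure_l b 1 x y; rewrite !scale1r. Qed.

Lemma spureDr a x y : spure a (x + y) = spure a x + spure a y.
Proof. by have := spure_r a 1 x y; rewrite !scale1r. Qed.

Lemma spureZl b k x : spure (k *: x) b = k *: spure x b.
Proof. by have := spure_l b k x 0; rewrite spure0l !addr0. Qed.

Lemma spureZr a k x : spure a (k *: x) = k *: spure a x.
Proof. by have := spure_r a k x 0; rewrite spure0r !addr0. Qed.

Lemma stens_mul_hom p q a b a' b' : hpart p b = b -> hpart q a' = a' ->
  stens_mul (spure a b) (spure a' b')
  = (-1) ^+ (p && q) *: spure (a * a') (b * b').
Proof.
move=> bp aq; rewrite stens_mul_pure (bigD1 p) //= [X in _ + X]big1.
  rewrite addr0 (bigD1 q) //= [X in _ + X]big1; first by rewrite addr0 bp aq.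
  by move=> r /negPf rq; rewrite -aq hpartK rq mulr0 spure0l scaler0.
move=> r /negPf rp; apply: big1 => s _.
by rewrite -bp hpartK rp mul0r spure0r scaler0.
Qed.

Lemma stens_ind (P : T -> Prop) :
  P 0 -> (forall x y, P x -> P y -> P (x + y)) ->
  (forall p q a b, hpart p a = a -> hpart q b = b -> P (spure a b)) ->
  forall x, P x.
Proof.
move=> P0 PD Phom; apply: (@tens_ind K A B P P0 PD) => a b.
rewrite -[pure a b]/(spure a b) -[a]hpart_sum -[b]hpart_sum.
rewrite !(spureDl, spureDr).
have Pab p q : P (spure (hpart p a) (hpart q b)).
  by apply: (Phom p q); rewrite hpartK eqxx.
by apply: (PD); apply: (PD).
Qed.

Definition stens_one : T := spure 1 1.

Lemma stens_mul1 : left_id stens_one stens_mul.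
Proof.
elim/stens_ind=> [|x y IHx IHy|p q a b ap bq]; first exact: stens_mul0r.
  by rewrite stens_mulDr IHx IHy.
by rewrite (stens_mul_hom _ _ hpart1 ap) scale1r !mul1r.
Qed.

Lemma stens_1mul : right_id stens_one stens_mul.
Proof.
elim/stens_ind=> [|x y IHx IHy|p q a b ap bq]; first exact: stens_mul0l.
  by rewrite stens_mulDl IHx IHy.
by rewrite (stens_mul_hom _ _ bq hpart1) andbF scale1r !mulr1.
Qed.

Lemma hpart_mul (S : superAlgType K) p q (x y : S) :
  hpart p x = x -> hpart q y = y -> hpart (p (+) q) (x * y) = x * y.
Proof. by move=> <- <-; rewrite hpartMM. Qed.

Lemma stens_mulA : associative stens_mul.
Proof.
move=> x y z.
elim/stens_ind: x => [|x x' IH IH'|p q a b ap bq].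
- by rewrite !stens_mul0l.
- by rewrite !stens_mulDl IH IH'.
elim/stens_ind: y => [|y y' IH IH'|p' q' a' b' ap' bq'].
- by rewrite !(stens_mul0l, stens_mul0r).
- by rewrite !(stens_mulDl, stens_mulDr) IH IH'.
elim/stens_ind: z => [|z z' IH IH'|p2 q2 a2 b2 ap2 bq2].
- by rewrite !stens_mul0r.
- by rewrite !stens_mulDr IH IH'.
rewrite (stens_mul_hom _ _ bq' ap2) (stens_mul_hom _ _ bq ap').
rewrite -stens_scaleAr -stens_scaleAl.
rewrite (stens_mul_hom _ _ bq (hpart_mul ap' ap2)).
rewrite (stens_mul_hom _ _ (hpart_mul bq bq') ap2) !scalerA !mulrA.
congr (_ *: _); rewrite -!exprD.
by case: q {bq}; case: q' {bq'}; case: p' {ap'}; case: p2 {ap2};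
  rewrite //= ?expr1 ?expr0 ?(mulrNN, sqrr_sign) // -signr_odd.
Qed.

HB.instance Definition _ := GRing.Zmodule_isPzRing.Build T
  stens_mulA stens_mul1 stens_1mul stens_mulDl stens_mulDr.

Definition tgr (r : bool) (a : A) (b : B) : T :=
  spure (hpart false a) (hpart r b) + spure (hpart true a) (hpart (~~ r) b).

Lemma tgr_bilinear r : bilinear_for *:%R *:%R (tgr r).
Proof.
by split=> [b k x y|a k x y] /=; rewrite /tgr !hpart_is_linear
  ?spure_l ?spure_r scalerDr addrACA.
Qed.

HB.instance Definition _ r := bilinear_isBilinear.Build K A B T *:%R *:%R
  (tgr r) (tgr_bilinear r).

(* The parity of a (x) b is the sum of the parities of a and b. *)
Definition stens_hpart (r : bool) (x : T) : T := tens_lift (tgr r) x.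

Lemma stens_hpartP r k x y :
  stens_hpart r (k *: x + y) = k *: stens_hpart r x + stens_hpart r y.
Proof. exact: tens_lift_linear. Qed.

Lemma stens_hpartD r x y :
  stens_hpart r (x + y) = stens_hpart r x + stens_hpart r y.
Proof. by have := stens_hpartP r 1 x y; rewrite !scale1r. Qed.

Lemma stens_hpart0 r : stens_hpart r 0 = 0.
Proof. by apply: (addrI (stens_hpart r 0)); rewrite -stens_hpartD !addr0. Qed.

Lemma stens_hpartZ r k x : stens_hpart r (k *: x) = k *: stens_hpart r x.
Proof. by have := stens_hpartP r k x 0; rewrite stens_hpart0 !addr0. Qed.

Lemma stens_hpart_hom r p q a b : hpart p a = a -> hpart q b = b ->
  stens_hpart r (spure a b) = if r == p (+) q then spure a b else 0.
Proof.
move=> ap bq; rewrite [LHS](lift_pure (tgr r)) /= /tgr -ap -bq !hpartK.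
by case: r; case: p {ap}; case: q {bq};
  rewrite /= ?(spure0l, spure0r) ?addr0 ?add0r.
Qed.

Lemma stens_hpart_sum x : stens_hpart false x + stens_hpart true x = x.
Proof.
elim/stens_ind: x => [|x y IHx IHy|p q a b ap bq].
- by rewrite !stens_hpart0 addr0.
- by rewrite !stens_hpartD addrACA IHx IHy.
by rewrite !(stens_hpart_hom _ ap bq); case: (p (+) q); rewrite ?addr0 ?add0r.
Qed.

Lemma stens_hpartK r s x :
  stens_hpart r (stens_hpart s x) = if r == s then stens_hpart s x else 0.
Proof.
elim/stens_ind: x => [|x y IHx IHy|p q a b ap bq].
- by rewrite !stens_hpart0; case: eqP.
- by rewrite !stens_hpartD IHx IHy; case: eqP; rewrite ?addr0.
rewrite !(stens_hpart_hom _ ap bq); case: (s =P _) => [->|ns].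
  by rewrite (stens_hpart_hom _ ap bq).
by rewrite stens_hpart0 if_same.
Qed.

Lemma stens_hpart1 : stens_hpart false 1 = 1.
Proof. by rewrite [LHS](stens_hpart_hom _ hpart1 hpart1). Qed.

Lemma stens_hpartMM r s (x y : T) :
  stens_hpart (r (+) s) (stens_hpart r x * stens_hpart s y)
  = stens_hpart r x * stens_hpart s y.
Proof.
elim/stens_ind: x => [|x x' IH IH'|p q a b ap bq].
- by rewrite !stens_hpart0 mul0r stens_hpart0.
- by rewrite !stens_hpartD mulrDl stens_hpartD IH IH'.
elim/stens_ind: y => [|y y' IH IH'|p' q' a' b' ap' bq'].
- by rewrite !stens_hpart0 mulr0 stens_hpart0.
- by rewrite !stens_hpartD mulrDr stens_hpartD IH IH'.
rewrite (stens_hpart_hom _ ap bq) (stens_hpart_hom _ ap' bq').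
case: (r =P _) => [->|_]; last by rewrite mul0r stens_hpart0.
case: (s =P _) => [->|_]; last by rewrite mulr0 stens_hpart0.
rewrite [_ * _ in LHS](stens_mul_hom _ _ bq ap') stens_hpartZ.
rewrite (stens_hpart_hom _ (hpart_mul ap ap') (hpart_mul bq bq')).
rewrite [RHS](stens_mul_hom _ _ bq ap').
by rewrite -!addbA [in q (+) _]addbCA eqxx.
Qed.

HB.instance Definition _ := PzRing_isSuperAlgebra.Build K T
  (@scalerA K T) (@scale1r K T) (@scalerDr K T) (@scalerDl K T)
  stens_scaleAl stens_scaleAr
  stens_hpartD stens_hpartZ stens_hpart_sum stens_hpartK stens_hpart1
  stens_hpartMM.

End SuperTensor.

Record orthRep (K : fieldType) (W : finGroupType) (V : lmodType K)
  (b : V -> V -> K) := OrthRep {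
  orep :> W -> V -> V;
  orep_linear : forall w, linear (orep w);
  orep1 : forall x, orep 1%g x = x;
  orepM : forall w w' x, orep (w * w')%g x = orep w (orep w' x);
  orep_inv : forall w x y, b (orep w x) (orep w y) = b x y
}.

Section CliffordAction.
Variables (K : fieldType) (W : finGroupType) (V : lmodType K).
Variables (b : V -> V -> K) (rho : orthRep W b).
Local Notation C := (clifford b).

Definition cliff_act (w : W) : C -> C :=
  @plift K V (clifford_pres b) C (fun x => cliff b (rho w x)).

Lemma cliff_act_rel w s t : clifford_rel b s t ->
  Teval (fun x => cliff b (rho w x)) s = Teval (fun x => cliff b (rho w x)) t.
Proof.
case=> [k x y|x y] /=; first by rewrite orep_linear cliff_linear.
by rewrite cliff_anticomm orep_inv.
Qed.

Lemma cliff_act_gen w x : cliff_act w (cliff b x) = cliff b (rho w x).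
Proof. exact/plift_gen/cliff_act_rel. Qed.

Lemma cliff_act_hom w : superalg_hom (cliff_act w).
Proof.
apply: plift_hom; first exact: cliff_act_rel.
by move=> x; rewrite [LHS](@pgen_odd K V (clifford_pres b)).
Qed.

Lemma superalg_hom_id (A : superAlgType K) : superalg_hom (@id A).
Proof. by []. Qed.

Lemma superalg_hom_comp (A B D : superAlgType K) (f : B -> D) (g : A -> B) :
  superalg_hom f -> superalg_hom g -> superalg_hom (f \o g).
Proof.
move=> [fL [f1 fM] fP] [gL [g1 gM] gP]; split.
- by move=> k x y; rewrite /= gL fL.
- by split=> [|x y] /=; rewrite ?g1 ?f1 // gM fM.
- by move=> p x; rewrite /= gP fP.
Qed.

Lemma cliff_act1 x : cliff_act 1%g x = x.
Proof.
apply: (presAlg_hom_ext (cliff_act_hom 1%g) (superalg_hom_id _)) => y.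
by rewrite [LHS]cliff_act_gen orep1.
Qed.

Lemma cliff_actM w w' x :
  cliff_act (w * w')%g x = cliff_act w (cliff_act w' x).
Proof.
apply: (presAlg_hom_ext (cliff_act_hom _)
          (superalg_hom_comp (cliff_act_hom w) (cliff_act_hom w'))) => y.
rewrite [LHS]cliff_act_gen orepM /=.
by rewrite [cliff_act w' _]cliff_act_gen cliff_act_gen.
Qed.

Definition cliff_action : superAction W C :=
  SuperAction cliff_act_hom cliff_act1 cliff_actM.

End CliffordAction.

Definition finite_cartan (R : realType) (n : nat) (A : 'M[int]_n) : Prop :=
  [/\ forall i, A i i = 2,
      forall i j, i != j -> A i j <= 0,
      forall i j, A i j = 0 -> A j i = 0
    & exists d : 'I_n -> R,
      [/\ forall i, 0 < d i,
          forall i j, d i * (A i j)%:~R = d j * (A j i)%:~R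
        & forall x : 'I_n -> R, (exists i, x i != 0) ->
            0 < \sum_i \sum_j x i * (d i * (A i j)%:~R) * x j]].

Definition indecomposable (n : nat) (A : 'M[int]_n) : Prop :=
  (0 < n)%N /\
  forall J : {set 'I_n}, J != set0 -> J != setT ->
    exists i j, [/\ i \in J, j \notin J & A i j != 0].

(* m_ij = 2, 3, 4, 6 according to a_ij a_ji = 0, 1, 2, 3; this product is     *)
(* less than 4 if i <> j and A is of finite type.                             *)
Definition coxeter_exp (n : nat) (A : 'M[int]_n) (i j : 'I_n) : nat :=
  if i == j then 1%N else nth 0%N [:: 2; 3; 4; 6]%N (absz (A i j * A j i)).

(* W is the group < s_1, ..., s_n | (s_i s_j) ^ m_ij = 1 >. *)
Definition coxeter_presentation (n : nat) (m : 'I_n -> 'I_n -> nat)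
    (W : finGroupType) (s : 'I_n -> W) : Prop :=
  [/\ <<[set s i | i : 'I_n]>>%g = [set: W],
      forall i j, ((s i * s j) ^+ m i j = 1)%g
    & forall (G : groupType) (r : 'I_n -> G),
        (forall i j, ((r i * r j) ^+ m i j = 1)%g) ->
        exists f : {multiplicative W -> G}, forall i, f (s i) = r i].

(* The simple roots of gl_(n+1): e_0, ..., e_n is an orthonormal basis of the *)
(* representation, on which the reflections act as transpositions.            *)
Definition gl_simple_roots (K : fieldType) (n : nat) (V : vectType K)
    (b : V -> V -> K) (alpha : 'I_n -> V) : Prop :=
  exists e : 'I_n.+1 -> V,
    [/\ basis_of fullv (codom e),
        forall i j, b (e i) (e j) = (i == j)%:R
      & forall i, alpha i = e (widen_ord (leqnSn n) i) - e (lift ord0 i)].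

Definition reflection_rep (K : fieldType) (n : nat) (A : 'M[int]_n)
    (W : finGroupType) (s : 'I_n -> W) (V : vectType K) (b : V -> V -> K)
    (rho : orthRep W b) (alpha : 'I_n -> V) : Prop :=
  [/\ basis_of fullv (codom alpha) \/ gl_simple_roots b alpha,
      forall i j, 2 * b (alpha i) (alpha j)
                  = (A i j)%:~R * b (alpha i) (alpha i)
    & forall i x, rho (s i) x
        = x - (2 * b x (alpha i) / b (alpha i) (alpha i)) *: alpha i].

Definition normalized_roots (K : numFieldType) (n : nat) (V : vectType K)
    (b : V -> V -> K) (alpha beta : 'I_n -> V) : Prop :=
  forall i, (exists2 c : K, 0 < c & beta i = c *: alpha i)
            /\ b (beta i) (beta i) = 2.

(* Main.v *)
Require Import Defs.
From HB Require Import structures.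
From mathcomp Require Import all_boot all_order all_fingroup all_algebra.
From mathcomp Require Import boolp reals complex.
From mathcomp Require Import ring.

Set Implicit Arguments.
Unset Strict Implicit.
Unset Printing Implicit Defensive.

Import GRing.Theory Num.Theory.
Local Open Scope ring_scope.

(* For x in h, s_i(x) beta_i = - beta_i x in the Clifford algebra C.          *)
(* Multiplication by beta_i therefore exchanges elements sigma_i that are     *)
(* even and act on C as s_i with elements tau_i that are odd and supercommute *)
(* with C. If tau_i = iota beta_i sigma_i with iota^2 = -1 then               *)
(* sigma_i sigma_j = (beta_i beta_j)(tau_i tau_j), the two factors commute,   *)
(* and (beta_i beta_j)^m_ij = (-1)^(m_ij + 1), so that (sigma_i sigma_j)^m_ij *)
(* is 1 exactly when (tau_i tau_j)^m_ij is (-1)^(m_ij + 1). The universal     *)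
(* properties of the smash product and of the super tensor product then give  *)
(* Phi and Psi, which are inverse to each other on generators.                *)

(** Conjugation by beta_i is - s_i on h ([cliff_reflectionl]), so the action of s_i on the Clifford
    algebra is inner up to sign. An odd t_i that supercommutes with C contributes the same sign, the
    two cancel, and beta_i t_i acts on C exactly as s_i does. It remains to match the braid
    relations. By [involutions_mul_sqr], u = beta_i beta_j satisfies u^2 = c u - 1 with c = (beta_i,
    beta_j), where c^2 = a_ij a_ji lies in {0, 1, 2, 3} by [finite_cartan_bound] and c <= 0.
    [quadratic_pow_coxeter] turns this into u^m_ij = (-1)^(m_ij + 1), the very sign of the spin
    relations. [smash_spin_lift] and [stens_spin_lift] build the two maps with an arbitrary target
    superalgebra; [spin_smash_iso] compares their composites with the identity on generators, so no
    basis or dimension count enters. *)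

Section RingUnits.
Variable R : pzRingType.

(* {unit R} is only available over finite rings, and GRing.unit only over    *)
(* non-trivial ones.                                                         *)
Record ring_units := RingUnits {
  uval : R;
  uinv : R;
  umulV : uval * uinv = 1;
  uVmul : uinv * uval = 1
}.

(** Two-sided inverses are unique and proofs are irrelevant, so the group laws can be checked on
    values in [R]. *)
Lemma uval_inj : injective uval.
Proof.
move=> [x x' xV Vx] [y y' yV Vy] /= xy.
have x'y' : x' = y' by rewrite -[x']mulr1 -yV -xy mulrA Vx mul1r.
by case: y / xy yV Vy => yV Vy; case: y' / x'y' yV Vy => yV Vy; congr RingUnits;
  apply: Prop_irrelevance.
Qed.

HB.instance Definition _ := gen_eqMixin ring_units.
HB.instance Definition _ := gen_choiceMixin ring_units.

Definition units_one := RingUnits (mulr1 1) (mulr1 1).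
Definition units_inv (x : ring_units) := RingUnits (uVmul x) (umulV x).

Lemma units_mul_subproof (x y : ring_units) :
  uval x * uval y * (uinv y * uinv x) = 1.
Proof. by rewrite mulrA -[_ * uinv y]mulrA umulV mulr1 umulV. Qed.

Definition units_mul (x y : ring_units) :=
  RingUnits (units_mul_subproof x y)
            (units_mul_subproof (units_inv y) (units_inv x)).

Lemma units_mulA : associative units_mul.
Proof. by move=> x y z; apply: uval_inj; rewrite /= mulrA. Qed.
Lemma units_mul1 : left_id units_one units_mul.
Proof. by move=> x; apply: uval_inj; rewrite /= mul1r. Qed.
Lemma units_1mul : right_id units_one units_mul.
Proof. by move=> x; apply: uval_inj; rewrite /= mulr1. Qed.
Lemma units_mulV : left_inverse units_one units_inv units_mul.
Proof. by move=> x; apply: uval_inj; rewrite /= uVmul. Qed.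
Lemma units_Vmul : right_inverse units_one units_inv units_mul.
Proof. by move=> x; apply: uval_inj; rewrite /= umulV. Qed.

HB.instance Definition _ := isGroup.Build ring_units
  units_mulA units_mul1 units_1mul units_mulV units_Vmul.

Lemma uvalX (x : ring_units) k : uval (x ^+ k)%g = uval x ^+ k.
Proof.
elim: k => [|k IHk]; first by rewrite expg0.
by rewrite expgS exprS -IHk.
Qed.

End RingUnits.

(** Since W is finite, the subgroup generated by the s_i consists of plain products of them;
    inverses need no separate case. *)
Lemma coxeter_ind (n : nat) (m : 'I_n -> 'I_n -> nat) (W : finGroupType)
    (s : 'I_n -> W) (P : W -> Prop) :
  coxeter_presentation m s -> P 1%g ->
  (forall i w, P w -> P (s i * w)%g) -> forall w, P w.
Proof.
move=> [genW _ _] P1 PM w; have: w \in <<[set s i | i : 'I_n]>>%g.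
  by rewrite genW inE.
case/gen_prodgP=> k [c cs ->].
elim: k c cs => [|k IHk] c cs; first by rewrite big_ord0.
rewrite big_ord_recl; case/imsetP: (cs ord0) => i _ ->; apply: PM.
by apply: (IHk (fun j => c (lift ord0 j))).
Qed.

(** The universal property of W concerns groups; it is applied to the unit group of [B], in which
    each [r i] is its own inverse. *)
Lemma coxeter_lift (n : nat) (m : 'I_n -> 'I_n -> nat) (W : finGroupType)
    (s : 'I_n -> W) (B : pzRingType) (r : 'I_n -> B) :
  coxeter_presentation m s -> (forall i, r i * r i = 1) ->
  (forall i j, (r i * r j) ^+ m i j = 1) ->
  exists F : W -> B, [/\ F 1%g = 1, forall w w', F (w * w')%g = F w * F w'
    & forall i, F (s i) = r i].
Proof.
move=> [_ _ univ] rV rX.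
pose u i := RingUnits (rV i) (rV i).
have uX i j : ((u i * u j) ^+ m i j = 1)%g.
  by apply: uval_inj; rewrite uvalX /= rX.
have [f fE] := univ _ u uX; exists (fun w => uval (f w)); split=> /=.
(* [f] is only given as preserving products; its value at 1 is an idempotent of a group. *)
- have : (f 1 * f 1 = f 1 * 1)%g by rewrite -gmulfM !mulg1.
  by move/mulgI => ->.
- by move=> w w'; rewrite gmulfM.
- by move=> i; rewrite fE.
Qed.

(** * Homomorphisms of superalgebras and induction on presented algebras *)

Section SuperHom.
Variables (K : fieldType) (A B : superAlgType K) (f : A -> B).
Hypothesis hf : superalg_hom f.

Lemma shomP k x y : f (k *: x + y) = k *: f x + f y.
Proof. by case: hf => fL _ _; rewrite fL. Qed.

Lemma shomD x y : f (x + y) = f x + f y.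
Proof. by have := shomP 1 x y; rewrite !scale1r. Qed.

Lemma shom0 : f 0 = 0.
Proof. by apply: (addrI (f 0)); rewrite -shomD !addr0. Qed.

Lemma shomZ k x : f (k *: x) = k *: f x.
Proof. by have := shomP k x 0; rewrite shom0 !addr0. Qed.

Lemma shomN x : f (- x) = - f x.
Proof. by rewrite -scaleN1r shomZ scaleN1r. Qed.

Lemma shom_sum (I : finType) (F : I -> A) :
  f (\sum_i F i) = \sum_i f (F i).
Proof. exact: (big_morph f shomD shom0). Qed.

Lemma shom1 : f 1 = 1. Proof. by case: hf => _ []. Qed.

Lemma shomM x y : f (x * y) = f x * f y.
Proof. by case: hf => _ [_ fM] _; rewrite fM. Qed.

Lemma shomX x k : f (x ^+ k) = f x ^+ k.
Proof. by elim: k => [|k IHk]; rewrite ?shom1 // !exprS shomM IHk. Qed.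

Lemma shom_hpart p x : f (hpart p x) = hpart p (f x).
Proof. by case: hf. Qed.

End SuperHom.

Lemma presAlg_ind (K : fieldType) (X : Type) (P : presentation K X)
    (Q : presAlg P -> Prop) :
  (forall x, Q (pgen P x)) -> Q 1 ->
  (forall k x y, Q x -> Q y -> Q (k *: x + y)) ->
  (forall x y, Q x -> Q y -> Q (x * y)) -> forall x, Q x.
Proof.
move=> Qgen Q1 QP QM.
have Q0 : Q 0 by rewrite -[0](addNr (1 : presAlg P)) -scaleN1r; apply: QP.
elim/TpiW; elim=> [x|||s IHs t IHt|s IHs|s IHs t IHt|k s IHs].
- exact: Qgen.
- exact: Q0.
- exact: Q1.
- by rewrite TpiD -[Tpi P s]scale1r; apply: QP.
- by rewrite TpiN -scaleN1r -[X in Q X]addr0; apply: QP.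
- by rewrite TpiM; apply: QM.
- by rewrite TpiZ -[X in Q X]addr0; apply: QP.
Qed.

(** * Supercommuting elements *)

Section SuperCommute.
Variables (K : fieldType) (B : superAlgType K).
Implicit Types x y z : B.

(** The vanishing of the supercommutator, tested on components because [x] and [y] may be
    inhomogeneous. *)
Definition scomm x y : Prop := forall p q,
  hpart p x * hpart q y = (-1) ^+ (p && q) *: (hpart q y * hpart p x).

Lemma scomm_sym x y : scomm x y -> scomm y x.
Proof.
by move=> xy p q; rewrite xy andbC scalerA -expr2 sqrr_sign scale1r.
Qed.

Lemma scomm1 x : scomm 1 x.
Proof.
move=> [] q; rewrite ?hpart_odd1 ?hpart1 /=.
  by rewrite mul0r mulr0 scaler0.
by rewrite mul1r mulr1 scale1r.
Qed.

Lemma scommP k x y z : scomm x z -> scomm y z -> scomm (k *: x + y) z.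
Proof.
move=> xz yz p q; rewrite hpart_is_linear mulrDl mulrDr -superAl -superAr xz yz.
by rewrite scalerDr !scalerA mulrC.
Qed.

(** Parities add in a product, so the Koszul signs of moving [z] past [y] and then past [x] multiply
    to the right one. *)
Lemma scommM x y z : scomm x z -> scomm y z -> scomm (x * y) z.
Proof.
move=> xz yz p q; rewrite hpartM mulrDl mulrDr scalerDr -!mulrA !yz.
rewrite -!superAr !mulrA !xz -!superAl !scalerA -!mulrA.
congr (_ *: _ + _ *: _); first by rewrite /= mulr1.
by case: p; case: q; rewrite /= ?mulrNN ?mulr1 ?mul1r.
Qed.

Lemma scomm_odd x y : hpart true x = x -> hpart true y = y ->
  x * y = - (y * x) -> scomm x y.
Proof.
move=> xo yo xy p q; rewrite -xo -yo !hpartK.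
case: p; case: q => /=;
  rewrite ?(mul0r, mulr0, scaler0) // xo yo xy expr1 scaleN1r //.
Qed.

End SuperCommute.

(** By [scommP] and [scommM] the elements supercommuting with a given one form a subalgebra, and
    [scomm_sym] lets this be used on either side. Only odd generators remain, where supercommuting
    means anticommuting. *)
Lemma scomm_gen (K : fieldType) (X Y : Type) (P : presentation K X)
    (Q : presentation K Y) (B : superAlgType K)
    (f : presAlg P -> B) (g : presAlg Q -> B) :
  superalg_hom f -> superalg_hom g ->
  (forall x y, f (pgen P x) * g (pgen Q y) = - (g (pgen Q y) * f (pgen P x))) ->
  forall a c, scomm (f a) (g c).
Proof.
move=> hf hg fg a c.
have odd_f x : hpart true (f (pgen P x)) = f (pgen P x).
  by rewrite -(shom_hpart hf) pgen_odd.
have odd_g y : hpart true (g (pgen Q y)) = g (pgen Q y).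
  by rewrite -(shom_hpart hg) pgen_odd.
elim/presAlg_ind: a => [x||k a a' IH IH'|a a' IH IH'].
- apply: scomm_sym; elim/presAlg_ind: c => [y||k c c' IH IH'|c c' IH IH'].
  + by apply: scomm_odd => //; rewrite fg opprK.
  + by rewrite (shom1 hg); apply: scomm1.
  + by rewrite (shomP hg); apply: scommP.
  + by rewrite (shomM hg); apply: scommM.
- by rewrite (shom1 hf); apply: scomm1.
- by rewrite (shomP hf); apply: scommP.
- by rewrite (shomM hf); apply: scommM.
Qed.

(** * The universal property of the super tensor product *)

Section StensUniversal.
Variables (K : fieldType) (A B : superAlgType K).

Lemma stens_mulE p q a b a' b' : hpart p b = b -> hpart q a' = a' ->
  (spure a b : stens A B) * spure a' b'
  = (-1) ^+ (p && q) *: spure (a * a') (b * b').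
Proof. exact: stens_mul_hom. Qed.

Lemma stens_hpartE r p q a b : hpart p a = a -> hpart q b = b ->
  hpart r (spure a b : stens A B) = if r == p (+) q then spure a b else 0.
Proof. exact: stens_hpart_hom. Qed.

Lemma spure_mul a b : (spure a 1 : stens A B) * spure 1 b = spure a b.
Proof.
by rewrite (stens_mulE _ _ hpart1 hpart1) scale1r mulr1 mul1r.
Qed.

(** The unit is even, so no sign arises; the argument is split into components only because
    [stens_mulE] asks for homogeneous factors. *)
Lemma spurel_hom : superalg_hom (fun a => spure a 1 : stens A B).
Proof.
split=> [k x y||p x]; first exact: spure_l.
- split=> // x y; rewrite -[y in RHS]hpart_sum spureDl mulrDr.
  have e p : hpart p (hpart p y) = hpart p y by rewrite hpartK eqxx.
  rewrite !(stens_mulE _ _ hpart1 (e _)) !scale1r -spureDl -mulrDr hpart_sum.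
  by rewrite mulr1.
- rewrite -[x in RHS]hpart_sum spureDl raddfD /=.
  have e r : hpart r (hpart r x) = hpart r x by rewrite hpartK eqxx.
  rewrite !(stens_hpartE _ (e _) hpart1).
  by case: p => /=; rewrite ?addr0 ?add0r.
Qed.

Lemma spurer_hom : superalg_hom (fun b => spure 1 b : stens A B).
Proof.
split=> [k x y||p x]; first exact: spure_r.
- split=> // x y; rewrite -[x in RHS]hpart_sum spureDr mulrDl.
  have e p : hpart p (hpart p x) = hpart p x by rewrite hpartK eqxx.
  rewrite !(stens_mulE _ _ (e _) hpart1) !andbF !scale1r -spureDr -mulrDl.
  by rewrite hpart_sum mulr1.
- rewrite -[x in RHS]hpart_sum spureDr raddfD /=.
  have e r : hpart r (hpart r x) = hpart r x by rewrite hpartK eqxx.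
  rewrite !(stens_hpartE _ hpart1 (e _)).
  by case: p => /=; rewrite ?addr0 ?add0r.
Qed.

Section Lift.
Variables (D : superAlgType K) (f : A -> D) (g : B -> D).
Hypotheses (hf : superalg_hom f) (hg : superalg_hom g).
Hypothesis fg : forall a b, scomm (f a) (g b).

Let mulfg a b := f a * g b.

Lemma mulfg_bilinear : bilinear_for *:%R *:%R mulfg.
Proof.
split=> [b k x y|a k x y] /=; rewrite /mulfg.
  by rewrite (shomP hf) mulrDl -superAl.
by rewrite (shomP hg) mulrDr -superAr.
Qed.

HB.instance Definition _ := bilinear_isBilinear.Build K A B D *:%R *:%R
  mulfg mulfg_bilinear.

Definition stens_lift (x : stens A B) : D := tens_lift mulfg x.

Lemma stens_liftP k x y :
  stens_lift (k *: x + y) = k *: stens_lift x + stens_lift y.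
Proof. exact: tens_lift_linear. Qed.

Lemma stens_liftD x y : stens_lift (x + y) = stens_lift x + stens_lift y.
Proof. by have := stens_liftP 1 x y; rewrite !scale1r. Qed.

Lemma stens_lift0 : stens_lift 0 = 0.
Proof. by apply: (addrI (stens_lift 0)); rewrite -stens_liftD !addr0. Qed.

Lemma stens_liftZ k x : stens_lift (k *: x) = k *: stens_lift x.
Proof. by have := stens_liftP k x 0; rewrite stens_lift0 !addr0. Qed.

Lemma stens_lift_pure a b : stens_lift (spure a b) = f a * g b.
Proof. exact: (lift_pure mulfg). Qed.

(** On homogeneous pure tensors, multiplicativity amounts to moving g(b) past f(a'), and [fg] gives
    the same sign as the product of the tensor algebra. *)
Lemma stens_lift_hom : superalg_hom stens_lift.
Proof.
split; first exact: stens_liftP.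
  split=> [|x y].
    by rewrite [LHS]stens_lift_pure (shom1 hf) (shom1 hg) mulr1.
  elim/stens_ind: x => [|x x' IH IH'|p q a b ap bq].
  - by rewrite mul0r stens_lift0 mul0r.
  - by rewrite mulrDl !stens_liftD mulrDl IH IH'.
  elim/stens_ind: y => [|y y' IH IH'|p' q' a' b' ap' bq'].
  - by rewrite mulr0 stens_lift0 mulr0.
  - by rewrite mulrDr !stens_liftD mulrDr IH IH'.
  rewrite (stens_mulE _ _ bq ap') stens_liftZ !stens_lift_pure.
  rewrite (shomM hf) (shomM hg) -!mulrA [g b * (f _ * _)]mulrA.
  have := scomm_sym (fg a' b) q p'.
  rewrite -(shom_hpart hf) -(shom_hpart hg) bq ap' => ->.
  by rewrite -superAl -superAr !mulrA.
move=> r x; elim/stens_ind: x => [|x x' IH IH'|p q a b ap bq].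
- by rewrite raddf0 stens_lift0 raddf0.
- by rewrite raddfD !stens_liftD raddfD IH IH'.
have fa : hpart p (f a) = f a by rewrite -(shom_hpart hf) ap.
have gb : hpart q (g b) = g b by rewrite -(shom_hpart hg) bq.
rewrite (stens_hpartE _ ap bq) stens_lift_pure -(hpart_mul fa gb) hpartK.
rewrite (hpart_mul fa gb).
by case: eqP => _; rewrite ?stens_lift0 // stens_lift_pure.
Qed.

End Lift.

Lemma stens_hom_ext (D : superAlgType K) (f g : stens A B -> D) :
  superalg_hom f -> superalg_hom g ->
  (forall a, f (spure a 1) = g (spure a 1)) ->
  (forall b, f (spure 1 b) = g (spure 1 b)) -> f =1 g.
Proof.
move=> hf hg fgA fgB; elim/stens_ind=> [|x y IH IH'|p q a b _ _].
- by rewrite (shom0 hf) (shom0 hg).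
- by rewrite (shomD hf) (shomD hg) IH IH'.
by rewrite -spure_mul (shomM hf) (shomM hg) fgA fgB.
Qed.

End StensUniversal.

(** * The universal property of the smash product *)

Section SmashUniversal.
Variables (K : fieldType) (W : finGroupType) (A : superAlgType K).
Variable act : superAction W A.
Local Notation S := (smash act).

Lemma smash_alg_mul a (x : S) w : (smash_alg act a * x) w = a * x w.
Proof.
rewrite smash_mulE (bigD1 1%g) //= big1 => [|u /negPf u1].
  by rewrite ffunE eqxx sact1 invg1 mul1g addr0.
by rewrite ffunE u1 mul0r.
Qed.

Lemma smash_grp_mul u (x : S) w :
  (smash_grp act u * x) w = act u (x (u^-1 * w)%g).
Proof.
rewrite smash_mulE (bigD1 u) //= big1 => [|v /negPf vu].
  by rewrite ffunE eqxx mul1r addr0.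
by rewrite ffunE vu mul0r.
Qed.

Lemma smash_grpM u v :
  smash_grp act (u * v)%g = smash_grp act u * smash_grp act v.
Proof.
apply/ffunP=> w; rewrite smash_grp_mul !ffunE -(inj_eq (mulgI u) _ v) mulKVg.
by case: eqP; rewrite ?sact_one ?raddf0.
Qed.

Lemma smash_grpX u k : smash_grp act (u ^+ k)%g = smash_grp act u ^+ k.
Proof. by elim: k => // k IHk; rewrite expgS exprS smash_grpM IHk. Qed.

Lemma smash_hpartE p (x : S) w : hpart p x w = hpart p (x w).
Proof. by rewrite [LHS]ffunE. Qed.

Lemma smash_grp_even u : hpart false (smash_grp act u) = smash_grp act u.
Proof.
apply/ffunP=> w; rewrite smash_hpartE !ffunE.
by case: eqP; rewrite ?hpart1 ?raddf0.
Qed.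

Lemma smash_alg_hom : superalg_hom (smash_alg act).
Proof.
split=> [k x y||p x].
- by apply/ffunP=> w; rewrite !ffunE; case: eqP; rewrite ?scaler0 ?addr0.
- split=> // x y; apply/ffunP=> w; rewrite smash_alg_mul !ffunE.
  by case: eqP; rewrite ?mulr0.
- apply/ffunP=> w; rewrite smash_hpartE !ffunE.
  by case: eqP; rewrite ?raddf0.
Qed.

Lemma smash_sum (x : S) : x = \sum_w smash_alg act (x w) * smash_grp act w.
Proof.
apply/ffunP=> w; rewrite sum_ffunE (bigD1 w) //= big1 => [|u /negPf uw].
  by rewrite smash_alg_mul ffunE eqxx mulr1 addr0.
by rewrite smash_alg_mul ffunE eq_sym uw mulr0.
Qed.

Section Lift.
Variables (D : superAlgType K) (f : A -> D) (F : W -> D).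
Hypothesis hf : superalg_hom f.
Hypotheses (F1 : F 1%g = 1) (FM : forall w w', F (w * w')%g = F w * F w').
Hypothesis F_even : forall w, hpart false (F w) = F w.
Hypothesis F_act : forall w a, F w * f a = f (act w a) * F w.

Definition smash_lift (x : S) : D := \sum_w f (x w) * F w.

Lemma smash_lift_alg a : smash_lift (smash_alg act a) = f a.
Proof.
rewrite /smash_lift (bigD1 1%g) //= big1 => [|u /negPf u1].
  by rewrite ffunE eqxx F1 mulr1 addr0.
by rewrite ffunE u1 (shom0 hf) mul0r.
Qed.

Lemma smash_lift_grp u : smash_lift (smash_grp act u) = F u.
Proof.
rewrite /smash_lift (bigD1 u) //= big1 => [|v /negPf vu].
  by rewrite ffunE eqxx (shom1 hf) mul1r addr0.
by rewrite ffunE vu (shom0 hf) mul0r.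
Qed.

(** The covariance relation [F_act] reproduces the twisted product of [smash]; as the F(w) are even,
    parity is carried by the coefficients alone. *)
Lemma smash_lift_hom : superalg_hom smash_lift.
Proof.
split=> [k x y||p x].
- rewrite /smash_lift scaler_sumr -big_split; apply: eq_bigr => w _ /=.
  by rewrite !ffunE (shomP hf) mulrDl superAl.
- split=> [|x y]; first by rewrite [LHS]smash_lift_alg (shom1 hf).
  rewrite /smash_lift mulr_suml.
  under eq_bigr => w _.
    rewrite smash_mulE (shom_sum hf) mulr_suml.
    under eq_bigr => u _ do rewrite (shomM hf).
    over.
  rewrite exchange_big; apply: eq_bigr => u _; rewrite mulr_sumr /=.
  (* Replacing w by u w turns the convolution argument u^-1 w into w. *)
  rewrite (reindex_inj (mulgI u)); apply: eq_bigr => w _.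
  by rewrite mulKg FM -!mulrA [F u * (f _ * _)]mulrA F_act !mulrA.
- rewrite raddf_sum; apply: eq_bigr => w _.
  have Fo : hpart true (F w) = 0 by rewrite -F_even hpartK.
  rewrite /= smash_hpartE (shom_hpart hf) hpartM.
  by case: p => /=; rewrite Fo F_even ?mulr0 ?addr0 ?add0r.
Qed.

End Lift.

Lemma smash_hom_ext (D : superAlgType K) (f g : S -> D) :
  superalg_hom f -> superalg_hom g ->
  (forall a, f (smash_alg act a) = g (smash_alg act a)) ->
  (forall w, f (smash_grp act w) = g (smash_grp act w)) -> f =1 g.
Proof.
move=> hf hg fgA fgW x; rewrite [x]smash_sum (shom_sum hf) (shom_sum hg).
by apply: eq_bigr => w _; rewrite (shomM hf) (shomM hg) fgA fgW.
Qed.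

End SmashUniversal.

Lemma Teval_exp (K : fieldType) (X : Type) (B : superAlgType K) (f : X -> B)
    (t : term K X) k : Teval f (Texp t k) = Teval f t ^+ k.
Proof. by elim: k => //= k ->; rewrite exprS. Qed.

(** * Powers of products of involutions and of anticommuting elements *)

(** The inverse of u = x y is y x, so the third hypothesis reads u + u^-1 = c; multiply it by u. *)
Lemma involutions_mul_sqr (K : fieldType) (A : superAlgType K) (x y : A) c :
  x * x = 1 -> y * y = 1 -> x * y + y * x = c *: (1 : A) ->
  x * y * (x * y) = c *: (x * y) - 1.
Proof.
move=> xx yy xy.
have inv : x * y * (y * x) = 1 by rewrite mulrA -[x * y * y]mulrA yy mulr1 xx.
by rewrite -inv -[X in c *: X]mulr1 superAr -xy mulrDr addrK.
Qed.

Section QuadraticPowers.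
Variables (K : fieldType) (A : superAlgType K) (u : A) (c : K).
Hypothesis uu : u * u = c *: u - 1.

Lemma quadratic_step a d :
  (a *: u + d *: (1 : A)) * u = (a * c + d) *: u + (- a) *: (1 : A).
Proof.
rewrite mulrDl -!superAl uu mul1r scalerBr scalerA scalerDl scaleNr.
by rewrite addrAC.
Qed.

(* If c = - 2 cos (pi / m) then the roots of X^2 - c X + 1 are the numbers    *)
(* - exp (i pi / m) and - exp (- i pi / m), whose m-th power is (-1)^(m+1).   *)
(* Here k = 4 cos^2 (pi / m), and the sign of c matters for m = 3 only.       *)
Lemma quadratic_pow_coxeter k : (k < 4)%N -> c ^+ 2 = k%:R ->
    (k = 1%N -> c = -1) ->
  let m := nth 0%N [:: 2; 3; 4; 6]%N k in u ^+ m = (-1) ^+ m.+1 *: (1 : A).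
Proof.
have u2 : u ^+ 2 = c *: u + (-1) *: (1 : A) by rewrite expr2 uu scaleN1r.
case: k => [|[|[|[|//]]]] _ /= c2 c1; rewrite -signr_odd /= ?expr1 ?expr0.
- rewrite u2; have -> : c = 0 by apply/eqP; rewrite -[c == 0](expf_eq0 c 2) c2.
  by rewrite scale0r add0r.
- rewrite exprSr u2 quadratic_step c1 //.
  by rewrite mulrNN mulr1 subrr scale0r add0r opprK.
- rewrite !(exprSr u 3, exprSr u 2) u2 !quadratic_step.
  have -> : (c * c - 1) * c - c = (c ^+ 2 - 2) * c by ring.
  have -> : - (c * c - 1) = 1 - c ^+ 2 by ring.
  by rewrite c2 subrr mul0r scale0r add0r; congr (_ *: _); ring.
- rewrite !(exprSr u 5, exprSr u 4, exprSr u 3, exprSr u 2) u2 !quadratic_step.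
  (* These are the coefficients of u^6 on u and on 1, rewritten to exhibit the factor c^2 - 3, which
     vanishes here. *)
  set a := (X in X *: u + _); set d := (X in _ + X *: _).
  have -> : a = (c ^+ 2 - 3) * (c ^+ 2 - 1) * c by rewrite /a; ring.
  have -> : d = - 1 - c ^+ 2 * (c ^+ 2 - 3) by rewrite /d; ring.
  by rewrite c2 subrr !mul0r mulr0 subr0 scale0r add0r.
Qed.

End QuadraticPowers.

Section SkewProduct.
Variables (R : pzRingType) (x y t u : R).
Hypothesis ty : t * y = - (y * t).

Lemma skew_mulACA : x * t * (y * u) = - (x * y * (t * u)).
Proof. by rewrite -mulrA [t * (y * u)]mulrA ty mulNr mulrN !mulrA. Qed.

Hypotheses (tx : t * x = - (x * t)) (ux : u * x = - (x * u)).
Hypothesis uy : u * y = - (y * u).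

(** Each of x and y passes both t and u, picking up two signs that cancel; hence x y commutes with t
    u. *)
Lemma skew_mulX k : (x * y * (t * u)) ^+ k = (x * y) ^+ k * (t * u) ^+ k.
Proof.
apply: exprMn_comm; rewrite /GRing.comm.
have tuC z : t * z = - (z * t) -> u * z = - (z * u) -> t * u * z = z * (t * u).
  by move=> tz uz; rewrite -mulrA uz mulrN mulrA tz mulNr opprK mulrA.
by rewrite -mulrA -(tuC y) // mulrA -(tuC x) // mulrA.
Qed.

End SkewProduct.

(** Positivity of the symmetrized form on the plane of the i-th and j-th basis vectors bounds the
    product by 4; it is nonnegative because both off-diagonal entries are nonpositive. *)
Lemma finite_cartan_bound (R : realType) (n : nat) (A : 'M[int]_n) i j :
  finite_cartan R A -> i != j -> exists2 k, (k < 4)%N & A i j * A j i = k%:Z.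
Proof.
move=> [A2 A0 _ [d [d0 dA pos]]] ij.
have ji : j != i by rewrite eq_sym.
have : 0 <= A i j * A j i by rewrite mulr_le0 ?A0.
case E: (A i j * A j i) => [k|//] _; exists k => //.
(* Twice the component of the j-th basis vector orthogonal to the i-th one; the form takes the value
   2 d_j (4 - a_ij a_ji) on it. *)
pose x l : R := if l == i then - (A i j)%:~R else if l == j then 2 else 0.
have := pos x.
have xi : x i = - (A i j)%:~R by rewrite /x eqxx.
have xj : x j = 2 by rewrite /x eqxx (negPf ji).
have x0 l : l != i -> l != j -> x l = 0.
  by move=> /negPf li /negPf lj; rewrite /x li lj.
have sum2 (F : 'I_n -> R) : (forall l, x l = 0 -> F l = 0) ->
    \sum_l F l = F i + F j.
  move=> F0; rewrite (bigD1 i) //= (bigD1 j) //= big1 ?addr0 // => l.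
  by move=> /andP[li lj]; apply/F0/x0.
rewrite sum2; last first.
  by move=> l xl; apply: big1 => r _; rewrite xl !mul0r.
rewrite !sum2; try by move=> l ->; rewrite mulr0.
rewrite xi xj !A2 => /(_ _)/wrap[]; first by exists j; rewrite xj pnatr_eq0.
have Ek : (A i j)%:~R * (A j i)%:~R = k%:R :> R by rewrite -intrM E.
have -> : - (A i j)%:~R * (d i * 2) * - (A i j)%:~R
    + - (A i j)%:~R * (d i * (A i j)%:~R) * 2
    + (2 * (d j * (A j i)%:~R) * - (A i j)%:~R + 2 * (d j * 2) * 2)
    = 2 * d j * (4 - (A i j)%:~R * (A j i)%:~R) :> R.
  by ring: (dA i j).
by rewrite Ek pmulr_rgt0 ?mulr_gt0 // subr_gt0 ltr_nat.
Qed.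

(** * Reflections in the Clifford algebra *)

Section Reflections.
Variables (K : fieldType) (W : finGroupType) (V : vectType K).
Variables (b : {symmetric V}) (rho : orthRep W b).
Local Notation C := (clifford b).

Lemma symformC x y : b x y = b y x.
Proof. by rewrite hermC expr0 mul1r. Qed.

Lemma symformZl k x y : b (k *: x) y = k * b x y.
Proof. exact: linearZl_LR. Qed.

Lemma symformZr k x y : b x (k *: y) = k * b x y.
Proof. by rewrite symformC symformZl symformC. Qed.

Section Root.
Variable beta : V.
Hypotheses (two_neq0 : 2 != 0 :> K) (beta2 : b beta beta = 2).

Lemma cliff_root_sqr : cliff b beta * cliff b beta = 1.
Proof.
apply: (@scalerI K (clifford b) 2) => //.
by rewrite -[in RHS]beta2 -cliff_anticomm scaler_nat mulr2n.
Qed.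

(** Since beta^2 = 1, the correction term contributes - b(x, beta), which is - (x beta + beta x) by
    the Clifford relation. *)
Lemma cliff_reflectionl x :
  cliff b (x - b x beta *: beta) * cliff b beta = - (cliff b beta * cliff b x).
Proof.
rewrite linearB linearZ /= mulrBl -superAl cliff_root_sqr -cliff_anticomm.
by rewrite opprD addNKr.
Qed.

Lemma cliff_reflectionr x :
  cliff b beta * cliff b (x - b x beta *: beta) = - (cliff b x * cliff b beta).
Proof.
rewrite linearB linearZ /= mulrBr -superAr cliff_root_sqr -cliff_anticomm.
by rewrite opprD addrC addrNK.
Qed.

End Root.
End Reflections.

(** The factor iota^2 = -1 absorbs the sign from exchanging t and y, which is why the generators are
    scaled by a square root of -1. *)
Lemma skew_scale_mulX (K : fieldType) (A : superAlgType K) (iota : K)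
    (x y t u : A) k :
  iota ^+ 2 = -1 -> t * x = - (x * t) -> t * y = - (y * t) ->
  u * x = - (x * u) -> u * y = - (y * u) ->
  (iota *: (x * t) * (iota *: (y * u))) ^+ k = (x * y) ^+ k * (t * u) ^+ k.
Proof.
move=> iota2 tx ty ux uy.
rewrite -superAl -superAr scalerA -expr2 iota2 skew_mulACA // scaleN1r opprK.
exact: skew_mulX.
Qed.

Lemma scale_sign_mul (K : fieldType) (A : superAlgType K) k :
  ((-1) ^+ k *: (1 : A)) * ((-1) ^+ k *: (1 : A)) = 1.
Proof. by rewrite -superAl mul1r scalerA -expr2 sqrr_sign scale1r. Qed.

(** With {k, l} = {iota, - iota} and x = beta_i, this says that the passages between sigma_i and
    tau_i are mutually inverse. *)
Lemma scale_involutionK (K : fieldType) (A : superAlgType K) (k l : K)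
    (x y : A) :
  k * l = 1 -> x * x = 1 -> k *: (x * (l *: (x * y))) = y.
Proof. by move=> kl xx; rewrite -superAr scalerA kl scale1r mulrA xx mul1r. Qed.

(** * The isomorphism, given the braid relations of the beta_i *)

Section SpinIsomorphism.
Variables (K : fieldType) (n : nat) (m : 'I_n -> 'I_n -> nat).
Variables (W : finGroupType) (s : 'I_n -> W).
Variables (V : vectType K) (b : {symmetric V}) (rho : orthRep W b).
Variables (beta : 'I_n -> V) (iota : K).
Hypothesis iota2 : iota ^+ 2 = -1.
Hypothesis two_neq0 : 2 != 0 :> K.
Hypothesis coxW : coxeter_presentation m s.
Hypothesis beta2 : forall i, b (beta i) (beta i) = 2.
Hypothesis reflE : forall i x, rho (s i) x = x - b x (beta i) *: beta i.
Local Notation C := (clifford b).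
Local Notation act := (cliff_action rho).
Local Notation CW := (spinalg K m).
Local Notation t := (spin K m).
Local Notation cbeta i := (cliff b (beta i)).
Hypothesis m_diag : forall i, m i i = 1%N.
Hypothesis beta_braid : forall i j,
  (cbeta i * cbeta j) ^+ m i j = (-1) ^+ (m i j).+1 *: (1 : C).

Lemma cliff_odd x : hpart true (cliff b x) = cliff b x.
Proof. exact: (@pgen_odd K V (clifford_pres b)). Qed.

Lemma spin_odd i : hpart true (t i) = t i.
Proof. exact: (@pgen_odd K _ (spin_pres K m)). Qed.

Section Lifts.
Variables (D : superAlgType K) (f : C -> D).
Hypothesis hf : superalg_hom f.

Lemma hom_cliff_braid i j : (f (cbeta i) * f (cbeta j)) ^+ m i j
  = (-1) ^+ (m i j).+1 *: (1 : D).
Proof.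
by rewrite -(shomM hf) -(shomX hf) beta_braid (shomZ hf) (shom1 hf).
Qed.

Lemma hom_cliff_sqr i : f (cbeta i) * f (cbeta i) = 1.
Proof. by rewrite -(shomM hf) cliff_root_sqr // (shom1 hf). Qed.

Lemma hom_cliff_odd x : hpart true (f (cliff b x)) = f (cliff b x).
Proof. by rewrite -(shom_hpart hf) cliff_odd. Qed.

Lemma smash_spin_lift (tau : 'I_n -> D) :
  (forall i, hpart true (tau i) = tau i) ->
  (forall i x, tau i * f (cliff b x) = - (f (cliff b x) * tau i)) ->
  (forall i j, (tau i * tau j) ^+ m i j = (-1) ^+ (m i j).+1 *: (1 : D)) ->
  exists Phi : smash act -> D, [/\ superalg_hom Phi,
    forall a, Phi (smash_alg act a) = f a
    & forall i, Phi (smash_grp act (s i)) = - iota *: (f (cbeta i) * tau i)].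
Proof.
move=> tau_odd tau_f tau_braid.
pose sigma i := - iota *: (f (cbeta i) * tau i).
have sigmaX i j : (sigma i * sigma j) ^+ m i j = 1.
  rewrite skew_scale_mulX ?sqrrN //.
  by rewrite hom_cliff_braid tau_braid scale_sign_mul.
have sigmaV i : sigma i * sigma i = 1.
  by have := sigmaX i i; rewrite m_diag expr1.
have sigma_even i : hpart false (sigma i) = sigma i.
  rewrite /sigma linearZ /=; congr (_ *: _).
  exact: (hpart_mul (hom_cliff_odd _) (tau_odd i)).
(* On a generator x, the sign from [tau_f] cancels the one in [cliff_reflectionl]; both sides then
   extend multiplicatively. *)
have sigma_act i a : sigma i * f a = f (act (s i) a) * sigma i.
  elim/presAlg_ind: a => [x||k x y IHx IHy|x y IHx IHy].
  - rewrite -[pgen _ x]/(cliff b x) [act _ _]cliff_act_gen reflE.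
    rewrite /sigma -superAl -superAr -mulrA tau_f mulrN !mulrA -!(shomM hf).
    by rewrite cliff_reflectionl // (shomN hf) mulNr.
  - by rewrite sact_one (shom1 hf) mulr1 mul1r.
  - rewrite linearP !(shomP hf) mulrDl mulrDr IHy -superAr IHx.
    by rewrite superAl.
  - by rewrite sact_mul !(shomM hf) mulrA IHx -mulrA IHy mulrA.
have [F [F1 FM Fs]] := coxeter_lift coxW sigmaV sigmaX.
have F_even w : hpart false (F w) = F w.
  move: w; apply: (coxeter_ind coxW) => [|i w IHw]; first by rewrite F1 hpart1.
  by rewrite FM Fs; apply: (hpart_mul (sigma_even i) IHw).
have F_act w a : F w * f a = f (act w a) * F w.
  move: w a; apply: (coxeter_ind coxW) => [|i w IHw] a.
    by rewrite F1 sact1 mulr1 mul1r.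
  by rewrite FM Fs sactM -mulrA IHw mulrA sigma_act mulrA.
exists (smash_lift f F); split=> [|a|i].
- exact: smash_lift_hom.
- exact: smash_lift_alg.
- by rewrite smash_lift_grp.
Qed.

Lemma stens_spin_lift (sigma : 'I_n -> D) :
  (forall i, hpart false (sigma i) = sigma i) ->
  (forall i x, sigma i * f x = f (act (s i) x) * sigma i) ->
  (forall i j, (sigma i * sigma j) ^+ m i j = 1) ->
  exists Psi : stens C CW -> D, [/\ superalg_hom Psi,
    forall a, Psi (spure a 1) = f a
    & forall i, Psi (spure 1 (t i)) = iota *: (f (cbeta i) * sigma i)].
Proof.
move=> sigma_even sigma_f sigmaX.
pose tau i := iota *: (f (cbeta i) * sigma i).
have tau_f i x : tau i * f (cliff b x) = - (f (cliff b x) * tau i).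
  rewrite /tau -superAl -superAr -mulrA sigma_f [act _ _]cliff_act_gen reflE.
  rewrite !mulrA -!(shomM hf) cliff_reflectionr // (shomN hf).
  by rewrite mulNr scalerN.
have sigmaE i : sigma i = - iota *: (f (cbeta i) * tau i).
  by rewrite scale_involutionK ?hom_cliff_sqr // mulNr -expr2 iota2 opprK.
have tau_odd i : hpart true (tau i) = tau i.
  rewrite /tau linearZ /=; congr (_ *: _).
  exact: (hpart_mul (hom_cliff_odd _) (sigma_even i)).
have tau_braid i j :
    (tau i * tau j) ^+ m i j = (-1) ^+ (m i j).+1 *: (1 : D).
  (* The power of tau_i tau_j is inverse to that of beta_i beta_j, a sign, hence equal to it. *)
  have := sigmaX i j; rewrite !sigmaE skew_scale_mulX ?sqrrN //.
  rewrite hom_cliff_braid => e.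
  by rewrite -[RHS]mulr1 -[X in _ = _ * X]e mulrA scale_sign_mul mul1r.
have tau_rel x y : @spin_rel K n m x y -> Teval tau x = Teval tau y.
  by case=> i j; rewrite Teval_exp /= tau_braid.
pose g : CW -> D := @plift K _ (spin_pres K m) D tau.
have g_t i : g (t i) = tau i by exact: plift_gen.
have hg : superalg_hom g by exact: plift_hom.
have fg : forall a c, scomm (f a) (g c).
  apply: scomm_gen => // x i.
  by rewrite [g _]g_t tau_f opprK.
exists (stens_lift f g); split=> [|a|i].
- exact: stens_lift_hom.
- by rewrite stens_lift_pure // (shom1 hg) mulr1.
- by rewrite stens_lift_pure // (shom1 hf) mul1r g_t.
Qed.

End Lifts.

(** The lifts are taken along the two embeddings of C. Both composites fix C, and they fix each s_i
    and t_i by [scale_involutionK]; these elements generate. *)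
Lemma spin_smash_iso :
  exists (Phi : smash act -> stens C CW) (Psi : stens C CW -> smash act),
    [/\ superalg_hom Phi /\ superalg_hom Psi,
        cancel Phi Psi /\ cancel Psi Phi,
        (forall x, Phi (smash_alg act x) = spure x 1) /\
        (forall i, Phi (smash_grp act (s i))
                   = - iota *: spure (cbeta i) (t i))
      & (forall x, Psi (spure x 1) = smash_alg act x) /\
        (forall i, Psi (spure 1 (t i))
                   = iota *: (smash_alg act (cbeta i)
                              * smash_grp act (s i)))].
Proof.
have hl := spurel_hom C CW; have hr := spurer_hom C CW.
have ha := smash_alg_hom act.
have [||i j|Phi [hPhi Phi_alg Phi_grp]] :=
    @smash_spin_lift _ _ hl (fun i => spure 1 (t i)).
- by move=> i; rewrite -(shom_hpart hr) spin_odd.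
- move=> i x; rewrite (stens_mulE _ _ (spin_odd i) (cliff_odd x)) spure_mul.
  by rewrite expr1 mul1r mulr1; apply: scaleN1r.
- by rewrite -(shomM hr) -(shomX hr) spin_braid (shomZ hr).
have [i|i x|i j|Psi [hPsi Psi_l Psi_t]] :=
    @stens_spin_lift _ _ ha (fun i => smash_grp act (s i)).
- exact: smash_grp_even.
- exact: smash_grp_alg.
- by case: coxW => _ sX _; rewrite -smash_grpM -smash_grpX sX.
have Phi_s i : Phi (smash_grp act (s i)) = - iota *: spure (cbeta i) (t i).
  by rewrite Phi_grp spure_mul.
exists Phi, Psi; split=> //; split.
- have hc := superalg_hom_comp hPsi hPhi.
  apply: (smash_hom_ext hc (superalg_hom_id _)) => [a|w] /=.
    by rewrite Phi_alg Psi_l.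
  move: w; apply: (coxeter_ind coxW) => [|i w IHw].
    by rewrite (shom1 hPhi) (shom1 hPsi).
  rewrite smash_grpM (shomM hPhi) (shomM hPsi) IHw Phi_grp (shomZ hPsi).
  rewrite (shomM hPsi) Psi_l Psi_t; congr (_ * _).
  apply: (scale_involutionK _ _ (hom_cliff_sqr ha i)).
  by rewrite mulNr -expr2 iota2 opprK.
- have hc := superalg_hom_comp hPhi hPsi.
  apply: (stens_hom_ext hc (superalg_hom_id _)) => [a|c] /=.
    by rewrite Psi_l Phi_alg.
  apply: (presAlg_hom_ext (superalg_hom_comp hc hr) hr) => i /=.
  rewrite [X in Psi X]/(spure 1 (t i)) Psi_t (shomZ hPhi) (shomM hPhi).
  rewrite Phi_alg Phi_grp; apply: (scale_involutionK _ _ (hom_cliff_sqr hl i)).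
  by rewrite mulrN -expr2 iota2 opprK.
Qed.

End SpinIsomorphism.

(** * Normalized simple roots and their braid relations *)

Section NormalizedRoots.
Variables (R : realType) (n : nat) (A : 'M[int]_n).
Variables (W : finGroupType) (s : 'I_n -> W) (V : vectType (complex R)).
Variables (b : {symmetric V}) (rho : orthRep W b) (alpha beta : 'I_n -> V).
Hypothesis cartanA : finite_cartan R A.
Hypothesis repA : reflection_rep A s rho alpha.
Hypothesis normA : normalized_roots b alpha beta.
Local Notation m := (coxeter_exp A).

Lemma normalized_rootsE i : exists c, [/\ 0 < c, beta i = c *: alpha i
  & c * (c * b (alpha i) (alpha i)) = 2].
Proof.
have [[c c0 cE] beta2] := normA i.
by exists c; split=> //; rewrite -beta2 cE symformZl symformZr.
Qed.

Lemma normalized_reflection i x : rho (s i) x = x - b x (beta i) *: beta i.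
Proof.
have [_ _ ->] := repA; have [c [c0 -> aa]] := normalized_rootsE i.
have a0 : b (alpha i) (alpha i) != 0.
  by apply: contra_eq_neq aa => ->; rewrite !mulr0 eq_sym pnatr_eq0.
by rewrite symformZr scalerA -aa; congr (_ - _ *: _); field.
Qed.

(** The ratio r of the two normalizing scalars symmetrizes the Cartan matrix: the two expressions
    multiply to a_ij a_ji, and the first one gives the sign, without any square root or cosine. *)
Lemma normalized_cartan i j : exists2 r, 0 < r
  & b (beta i) (beta j) = (A i j)%:~R * r
    /\ b (beta i) (beta j) = (A j i)%:~R / r.
Proof.
have [_ aA _] := repA.
have [c [c0 -> ci]] := normalized_rootsE i.
have [d [d0 -> dj]] := normalized_rootsE j.
have cn0 := lt0r_neq0 c0; have dn0 := lt0r_neq0 d0.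
have two : 2 != 0 :> complex R by rewrite pnatr_eq0.
have key x y (a : complex R) v w : x != 0 -> x * (x * v) = 2 ->
    2 * w = a * v -> x * (y * w) = a * (y / x).
  move=> x0 xv wv; apply: (mulfI two).
  by rewrite mulrCA [2 * _]mulrCA mulrCA wv -xv; field.
exists (d / c); first by rewrite divr_gt0.
rewrite symformZl symformZr; split; first exact: key ci (aA i j).
by rewrite invf_div mulrCA [b _ _]symformC; apply: key dj (aA j i).
Qed.

Lemma normalized_braid i j : (cliff b (beta i) * cliff b (beta j)) ^+ m i j
  = (-1) ^+ (m i j).+1 *: (1 : clifford b).
Proof.
have two : 2 != 0 :> complex R by rewrite pnatr_eq0.
have sqr1 l : cliff b (beta l) * cliff b (beta l) = 1.
  by apply: cliff_root_sqr => //; have [] := normA l.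
rewrite /coxeter_exp; case: (i =P j) => [<-|/eqP ij].
  by rewrite expr1 sqr1 expr2 mulrNN mulr1 scale1r.
have [k k4 Ak] := finite_cartan_bound cartanA ij; rewrite Ak.
have [r r0 [bij bji]] := normalized_cartan i j.
have uu := involutions_mul_sqr (sqr1 i) (sqr1 j)
  (cliff_anticomm b (beta i) (beta j)).
have bk : b (beta i) (beta j) ^+ 2 = k%:R.
  rewrite expr2 {1}bij bji mulrACA mulfV ?lt0r_neq0 // mulr1.
  by rewrite -intrM Ak.
(* For k = 1 the square leaves c = 1 or c = -1, and the nonpositive off-diagonal Cartan entries
   exclude c = 1. *)
apply: (quadratic_pow_coxeter uu k4 bk) => k1.
have /orP[/eqP b1|/eqP //] : (b (beta i) (beta j) == 1)
    || (b (beta i) (beta j) == -1) by rewrite -sqrf_eq1 bk k1.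
have [_ A0 _ _] := cartanA.
have : b (beta i) (beta j) <= 0.
  by rewrite bij pmulr_lle0 // lerz0 A0.
by rewrite b1 ler10.
Qed.

End NormalizedRoots.

Theorem theorem2p4 (R : realType) (n : nat) (A : 'M[int]_n)
    (W : finGroupType) (s : 'I_n -> W)
    (h : vectType (complex R)) (b : {symmetric h}) (rho : orthRep W b)
    (alpha beta : 'I_n -> h) :
  finite_cartan R A -> indecomposable A ->
  coxeter_presentation (coxeter_exp A) s ->
  nondegenerate b ->
  reflection_rep A s rho alpha ->
  normalized_roots b alpha beta ->
  let C := clifford b in
  let act := cliff_action rho in
  let CW := spinalg (complex R) (coxeter_exp A) in
  let t := spin (complex R) (coxeter_exp A) in
  exists (Phi : smash act -> stens C CW) (Psi : stens C CW -> smash act),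
    [/\ superalg_hom Phi /\ superalg_hom Psi,
        cancel Phi Psi /\ cancel Psi Phi,
        (forall x, Phi (smash_alg act x) = spure x 1) /\
        (forall i, Phi (smash_grp act (s i))
                   = - 'i%C *: spure (cliff b (beta i)) (t i))
      & (forall x, Psi (spure x 1) = smash_alg act x) /\
        (forall i, Psi (spure 1 (t i))
                   = 'i%C *: (smash_alg act (cliff b (beta i))
                              * smash_grp act (s i)))].
Proof.
move=> cartanA _ coxW _ repA normA /=.
apply: spin_smash_iso => //.
- exact: sqr_i.
- by rewrite pnatr_eq0.
- by move=> i; have [] := normA i.
- exact: normalized_reflection repA normA.
- by move=> i; rewrite /coxeter_exp eqxx.
- exact: normalized_braid cartanA repA normA.
Qed.
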